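(* There is an algorithm which, given as input a finite simple properly edge-colored graph $G$ with minimum degree $\delta(G)\ge 1$ satisfying $$|V(G)| > \frac{13}{2}\delta(G) - \frac{23}{2} + \frac{41}{8\,\delta(G)},$$ outputs a rainbow matching of size $\delta(G)$ in $G$ and runs in time $O(\delta(G)\,|V(G)|^2)$.
   Context: All graphs are finite and simple. $\delta(G)$ denotes the minimum degree of $G$. A proper edge-coloring assigns a color to each edge so that any two distinct edges sharing an endpoint receive distinct colors. A rainbow matching in an edge-colored graph is a matching (a set of pairwise disjoint edges) in which all edges have distinct colors; its size is its number of edges. Running time is the number of elementary operations in the usual sense for graph algorithms. *)

(* Defs.v *)
From HB Require Import structures.
From mathcomp Require Import all_boot all_order all_algebra.

Set Implicit Arguments.
Unset Strict Implicit.
Unset Printing Implicit Defensive.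

Record sgraph (n : nat) := SGraph {
  adj : rel 'I_n;
  adj_sym : symmetric adj;
  adj_irr : irreflexive adj
}.

Definition edges (n : nat) (G : sgraph n) : {set {set 'I_n}} :=
  [set [set u; v] | u in 'I_n, v in 'I_n & adj G u v].

Definition degree (n : nat) (G : sgraph n) (v : 'I_n) : nat :=
  #|[set u | adj G v u]|.

(* Every degree is smaller than n, so the default value n of the iterated
   minimum is never attained unless n = 0, where it yields 0. *)
Definition min_degree (n : nat) (G : sgraph n) : nat :=
  \big[minn/n]_(v < n) degree G v.

(* Only the values of col on edges G are ever used. *)
Definition proper_edge_coloring (n : nat) (G : sgraph n)
    (col : {set 'I_n} -> nat) : Prop :=
  forall e f : {set 'I_n}, e \in edges G -> f \in edges G ->
    e != f -> e :&: f != set0 -> col e != col f.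

Definition rainbow_matching (n : nat) (G : sgraph n)
    (col : {set 'I_n} -> nat) (M : {set {set 'I_n}}) : Prop :=
  [/\ M \subset edges G, trivIset M & {in M &, injective col}].

(* Programs are finite syntactic objects, run on a word RAM: scalar variables
   and zero-initialized arrays, both with statically known names, hold natural
   numbers not exceeding a word bound W.  Every operator, constant, variable
   access, array access, assignment and test costs one unit.  A computation in
   which some value exceeds W has no result (see fits), so that unit-cost
   arithmetic cannot be abused on huge integers. *)

Record state := State { vars : nat -> nat; arrs : nat -> nat -> nat }.

Definition set_var (s : state) (x k : nat) : state :=
  State (fun y => if y == x then k else vars s y) (arrs s).

Definition set_arr (s : state) (a i k : nat) : state :=
  State (vars s)
        (fun b j => if (b == a) && (j == i) then k else arrs s b j).

Variant binop := OpAdd | OpSub | OpMul | OpDiv | OpMod | OpEq | OpLt.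

Definition binop_eval (o : binop) (x y : nat) : nat :=
  match o with
  | OpAdd => x + y
  | OpSub => x - y
  | OpMul => x * y
  | OpDiv => x %/ y
  | OpMod => x %% y
  | OpEq => x == y
  | OpLt => x < y
  end.

Inductive expr :=
  | ECst of nat
  | EVar of nat
  | EArr of nat & expr
  | EBin of binop & expr & expr.

Fixpoint eval (s : state) (e : expr) : nat :=
  match e with
  | ECst k => k
  | EVar x => vars s x
  | EArr a i => arrs s a (eval s i)
  | EBin o e1 e2 => binop_eval o (eval s e1) (eval s e2)
  end.

(* No value computed while evaluating e overflows a word. *)
Fixpoint fits (W : nat) (s : state) (e : expr) : bool :=
  (eval s e <= W) &&
  match e with
  | ECst _ | EVar _ => true
  | EArr _ i => fits W s i
  | EBin _ e1 e2 => fits W s e1 && fits W s e2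
  end.

Fixpoint ecost (e : expr) : nat :=
  match e with
  | ECst _ | EVar _ => 1
  | EArr _ i => (ecost i).+1
  | EBin _ e1 e2 => (ecost e1 + ecost e2).+1
  end.

Inductive cmd :=
  | CSkip
  | CSet of nat & expr
  | CPut of nat & expr & expr
  | CSeq of cmd & cmd
  | CIf of expr & cmd & cmd
  | CWhile of expr & cmd.

(* exec W c s t s' : on words bounded by W, the program c started in state s
   halts after exactly t elementary operations in state s'. *)
Inductive exec (W : nat) : cmd -> state -> nat -> state -> Prop :=
  | ExSkip s : exec W CSkip s 1 s
  | ExSet s x e : fits W s e ->
      exec W (CSet x e) s (ecost e).+1 (set_var s x (eval s e))
  | ExPut s a i e : fits W s i -> fits W s e ->
      exec W (CPut a i e) s (ecost i + ecost e).+1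
           (set_arr s a (eval s i) (eval s e))
  | ExSeq s1 s2 s3 c1 c2 t1 t2 :
      exec W c1 s1 t1 s2 -> exec W c2 s2 t2 s3 ->
      exec W (CSeq c1 c2) s1 (t1 + t2) s3
  | ExIfT s s' e c1 c2 t : fits W s e -> eval s e != 0 ->
      exec W c1 s t s' -> exec W (CIf e c1 c2) s (ecost e + t).+1 s'
  | ExIfF s s' e c1 c2 t : fits W s e -> eval s e = 0 ->
      exec W c2 s t s' -> exec W (CIf e c1 c2) s (ecost e + t).+1 s'
  | ExWhileT s1 s2 s3 e c t1 t2 : fits W s1 e -> eval s1 e != 0 ->
      exec W c s1 t1 s2 -> exec W (CWhile e c) s2 t2 s3 ->
      exec W (CWhile e c) s1 (ecost e + t1 + t2).+1 s3
  | ExWhileF s e c : fits W s e -> eval s e = 0 ->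
      exec W (CWhile e c) s (ecost e).+1 s.

(* Variable 0 holds n; array 0 holds, in row-major order, the n x n adjacency
   matrix in which a non-edge is 0 and an edge of color c is c + 1.  The minimum
   degree is not part of the input.  Everything else is 0. *)
Definition matrix_entry (n : nat) (G : sgraph n) (col : {set 'I_n} -> nat)
    (i j : nat) : nat :=
  match insub i : option 'I_n, insub j : option 'I_n with
  | Some u, Some v => if adj G u v then (col [set u; v]).+1 else 0
  | _, _ => 0
  end.

Definition input (n : nat) (G : sgraph n) (col : {set 'I_n} -> nat) : state :=
  State (fun x => if x == 0 then n else 0)
        (fun a k => if a == 0 then matrix_entry G col (k %/ n) (k %% n) else 0).

(* In the final state, variable 1 holds the number m of listed edges, and the
   i-th listed edge has ends a[2i] and a[2i + 1], where a is array 1. *)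
Definition output (s : state) : seq (nat * nat) :=
  mkseq (fun i => (arrs s 1 (2 * i), arrs s 1 (2 * i + 1))) (vars s 1).

(* The final state s lists each member of M exactly once. *)
Definition outputs (n : nat) (s : state) (M : {set {set 'I_n}}) : Prop :=
  exists l : seq ('I_n * 'I_n),
    let L := [seq [set p.1; p.2] | p <- l] in
    [/\ output s = [seq (val p.1, val p.2) | p <- l], uniq L & M = [set:: L]].

Definition max_color (n : nat) (G : sgraph n) (col : {set 'I_n} -> nat) : nat :=
  \max_(e in edges G) col e.

(* Words of O(log (n + max_color)) bits: the bound is polynomial in the largest
   numbers needed to write down the input. *)
Definition word_bound (K d n : nat) (G : sgraph n)
    (col : {set 'I_n} -> nat) : nat :=
  K * (n + max_color G col + 1) ^ d.

(* Main.v *)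
Require Import Defs.
From HB Require Import structures.
From mathcomp Require Import all_boot all_order all_algebra.
From mathcomp Require Import zify ring.

Set Implicit Arguments.
Unset Strict Implicit.
Unset Printing Implicit Defensive.

(** Let d be the minimum degree and n the order of G.  The program goes down
    the levels r = d, ..., 1, keeping a graph of live edges in which a rainbow
    matching of size r is still wanted.

    A vertex of live degree at least 3r-2, or a color with at least 2r-1 live
    edges, is set aside (deleted).  A rainbow matching of size r-1 found in the
    remaining graph covers 2r-2 vertices and uses r-1 colors, which cannot block
    every edge at that vertex, or every edge of that color; so it extends
    (rainbow_extend_vertex, rainbow_extend_color).  When nothing can be set
    aside, an edge xy is picked: x, y and the color of xy are deleted.  Every
    matching of the remaining graph extends by xy itself.

    The point is that live edges never run out.  Let q be the level at which the
    first edge is picked, and measure the live graph by the potential, which is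
    the sum over all vertices of min(degree, q).  Before level q only vertices
    and colors were deleted, so that all but d-q vertices still have degree at
    least q, and the potential is at least q(n-d+q).  From then on all degrees
    are at most 3q-3 and all colors have at most 2q-2 edges, and one level costs
    at most 4q+4r-8.  This is clear when something is set aside.  When an edge is
    picked, the program prefers edges with few ends of degree above q.  If both
    ends are at most q, the count is direct (potential_low_low).  Otherwise no
    edge joins two vertices of degree at most q, and a vertex of degree above q
    pays nothing for the first edge that it loses; this compensates for the
    degree of x, which can be as large as 3r-3 (potential_high_low,
    potential_high_high).  The costs of the levels q, ..., 2 add up to
    (q-1)(6q-4), and the hypothesis on n gives (q-1)(6q-4) < q(n-d+q): for q = d
    this holds because the two bounds on dn differ by (2d-3)^2 / 8, and smaller q
    are easier.

    A deletion at level r is recorded by a stamp r on the vertex or color.  The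
    live graph of level r then consists of the edges whose stamps are all at most
    r, and the second phase goes up r = 1, ..., d and adds any edge of that graph
    which is disjoint from the edges chosen so far and has a new color; what was
    set aside at which level need not be remembered.  Each level of each phase
    takes a bounded number of scans of the adjacency matrix, hence the running
    time O(d n^2).

    Programs are handled by weakest preconditions for loop-free code and by
    invariants for loops.  Overflow is excluded once and for all: when all
    variables and array cells stay below B, every intermediate value is below a
    bound that depends only on the program text (efits). *)

(** * Colored graphs and the potential *)

Section Rainbow.

Variables (V : finType) (c : V -> V -> nat).
Implicit Types (E : rel V) (l : seq (V * V)).

Definition colored_graph E :=
  [/\ symmetric E, irreflexive E, forall x y, c x y = c y x
    & forall x y z, E x y -> E x z -> c x y = c x z -> y = z].

Definition deg E (v : V) : nat := \sum_w E v w.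

(** This is 0 or 1 when the coloring is proper. *)
Definition cdeg E k (v : V) : nat := \sum_w (E v w && (c v w == k)).

(** Every edge of color [k] is counted twice, once at each end. *)
Definition class_size E k : nat := \sum_v cdeg E k v.

Definition potential q E : nat := \sum_v minn (deg E v) q.

(** Deletions are stated as relations between the old and the new graph, since
    the program only produces the new graph up to pointwise equality. *)
Definition del_vertex E E' v :=
  forall a b, E' a b = [&& E a b, a != v & b != v].

Definition del_color E E' k :=
  forall a b, E' a b = E a b && (c a b != k).

Definition del_edge E E' x y :=
  forall a b,
    E' a b = [&& E a b, a != x, a != y, b != x, b != y & c a b != c x y].

Lemma sum_pred1 (f : V -> nat) v : \sum_z (z == v) * f z = f v.
Proof.
rewrite (bigD1 v) //= eqxx mul1n big1 ?addn0 // => z /negbTE ->.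
by rewrite mul0n.
Qed.

(** Pigeonhole: distinct [w] have distinct images in [s]. *)
Lemma sum_mem_inj (P : pred V) (T : eqType) (f : V -> T) (s : seq T) :
    {in P &, injective f} ->
  \sum_w (P w && (f w \in s)) <= size s.
Proof.
move=> injf; pose A := [pred w | P w && (f w \in s)].
have ->: \sum_w (P w && (f w \in s)) = size (map f (enum A)).
  by rewrite size_map -cardE -sum1_card [RHS]big_mkcond; apply: eq_bigr => w _;
    rewrite -[w \in A]/(P w && (f w \in s)); case: (_ && _).
apply: uniq_leq_size.
  rewrite map_inj_in_uniq ?enum_uniq // => a b.
  by rewrite !mem_enum => /andP[Pa _] /andP[Pb _]; apply: injf.
by move=> t /mapP[w]; rewrite mem_enum => /andP[_ ?] ->.
Qed.

Lemma sum_mem (s : seq V) : \sum_w (w \in s) <= size s.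
Proof. by have := @sum_mem_inj predT V id s (in2W (@inj_id V)). Qed.

Lemma cdeg_le1 E k v : colored_graph E -> cdeg E k v <= 1.
Proof.
case=> _ _ _ prop; rewrite /cdeg.
have := @sum_mem_inj (E v) nat (c v) [:: k] _; rewrite /=.
under eq_bigr => w do rewrite inE.
by apply=> a b Ea Eb; apply: prop.
Qed.

Lemma cdeg_edge E x y : colored_graph E -> E x y -> cdeg E (c x y) x = 1.
Proof.
move=> cgE Exy; apply/eqP; rewrite eqn_leq cdeg_le1 //=.
by rewrite /cdeg (bigD1 y) //= Exy eqxx.
Qed.

Lemma sub_colored_graph E E' : colored_graph E -> symmetric E' ->
  subrel E' E -> colored_graph E'.
Proof.
case=> symE irrE symc prop symE' sub; split=> // [x|x y z /sub + /sub].
  by apply/negP => /sub; rewrite irrE.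
exact: prop.
Qed.

Lemma del_vertex_colored E E' v :
  colored_graph E -> del_vertex E E' v -> colored_graph E'.
Proof.
move=> cgE dE; apply: (sub_colored_graph cgE).
  by case: cgE => symE _ _ _ a b; rewrite !dE symE; congr andb; rewrite andbC.
by move=> a b; rewrite dE => /andP[].
Qed.

Lemma del_edge_colored E E' x y :
  colored_graph E -> del_edge E E' x y -> colored_graph E'.
Proof.
move=> cgE dE; apply: (sub_colored_graph cgE).
  case: cgE => symE _ symc _ a b; rewrite !dE symE symc.
  by do 5![case: (_ == _); rewrite ?andbF //=].
by move=> a b; rewrite dE => /andP[].
Qed.

Lemma sub_deg E E' v : subrel E' E -> deg E' v <= deg E v.
Proof. by move=> sub; apply: leq_sum => w _; case: (E' v w) / boolP => // /sub ->. Qed.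

Lemma sub_class_size E E' k : subrel E' E -> class_size E' k <= class_size E k.
Proof.
move=> sub; apply: leq_sum => v _; apply: leq_sum => w _.
by case: (E' v w) / boolP => // /sub ->.
Qed.

Lemma deg_del_vertex E E' v z :
  del_vertex E E' v -> z != v -> deg E z <= deg E' z + E z v.
Proof.
move=> dE nzv; rewrite -(sum_pred1 (fun w => E z w : nat) v) -big_split /=.
by apply: leq_sum => w _; rewrite dE nzv /=; case: (E z w); case: (w == v).
Qed.

Lemma deg_del_color E E' k z :
  del_color E E' k -> deg E z <= deg E' z + cdeg E k z.
Proof.
move=> dE; rewrite /deg /cdeg -big_split /=.
by apply: leq_sum => w _; rewrite dE; case: (E z w); case: (_ == k).
Qed.

Lemma deg_del_edge E E' x y z : del_edge E E' x y -> z != x -> z != y ->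
  deg E z <= deg E' z + E z x + E z y + cdeg E (c x y) z.
Proof.
move=> dE nzx nzy; rewrite -(sum_pred1 (fun w => E z w : nat) x).
rewrite -(sum_pred1 (fun w => E z w : nat) y) -!big_split /=.
apply: leq_sum => w _; rewrite dE nzx nzy /=.
by case: (E z w); case: (w == x); case: (w == y); case: (_ == c x y).
Qed.

(** The vertex itself accounts for at most [q], and each neighbor for at most 1. *)
Lemma potential_del_vertex q E E' v : symmetric E -> del_vertex E E' v ->
  potential q E <= potential q E' + q + deg E v.
Proof.
move=> symE dE.
have ->: potential q E' + q + deg E v =
         \sum_z (minn (deg E' z) q + (z == v) * q + E v z).
  by rewrite !big_split /= (sum_pred1 (fun=> q)).
apply: leq_sum => z _; have [->|nzv] := eqVneq z v; first lia.
have := deg_del_vertex dE nzv; rewrite symE; lia.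
Qed.

Lemma potential_del_color q E E' k : del_color E E' k ->
  potential q E <= potential q E' + class_size E k.
Proof.
move=> dE; rewrite /potential /class_size -!big_split /=.
apply: leq_sum => z _; have := deg_del_color z dE; lia.
Qed.

(** The cost of picking an edge, when no vertex or color can be set aside at level
    [r].  In each case the loss is bounded vertex by vertex, and the bounds are
    added up. *)
Section DelEdge.

Variables (q r : nat) (E E' : rel V) (x y : V).
Hypotheses (cgE : colored_graph E) (Exy : E x y) (dE : del_edge E E' x y).
Hypotheses (r_gt1 : 1 < r) (le_r_q : r <= q).
Hypothesis deg_le : forall v, deg E v <= 3 * r - 3.
Hypothesis class_le : forall k, class_size E k <= 4 * r - 4.

Let symE : symmetric E. Proof. by case: cgE. Qed.
Let nxx a : E a a = false. Proof. by case: cgE => _ ->. Qed.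
Let nxy : x != y. Proof. by apply: contraTneq Exy => ->; rewrite nxx. Qed.
Let k := c x y.
Let cx : cdeg E k x = 1. Proof. exact: cdeg_edge. Qed.
Let cy : cdeg E k y = 1.
Proof. by case: (cgE) => _ _ symc _; rewrite /k symc cdeg_edge // symE. Qed.
Let dz z : z != x -> z != y ->
  deg E z <= deg E' z + E x z + E y z + cdeg E k z.
Proof. by move=> zx zy; rewrite (symE x) (symE y); apply: deg_del_edge. Qed.
Let cz z : cdeg E k z <= 1. Proof. exact: cdeg_le1. Qed.

(** At [x] and at [y], the cap [q] already covers the edge [xy] and its color,
    which the sums of degrees and of the color class count once more. *)
Lemma potential_low_low : deg E x <= q -> deg E y <= q ->
  potential q E <= potential q E' + (4 * q + 4 * r - 8).
Proof.
move=> lx ly.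
suff: potential q E + 2 + 2 <=
      potential q E' + q + q + deg E x + deg E y + class_size E k.
  have := class_le k; lia.
have ->: potential q E + 2 + 2 =
         \sum_z (minn (deg E z) q + (z == x) * 2 + (z == y) * 2).
  by rewrite !big_split /= !(sum_pred1 (fun=> 2)).
have ->: potential q E' + q + q + deg E x + deg E y + class_size E k =
         \sum_z (minn (deg E' z) q + (z == x) * q + (z == y) * q
                + E x z + E y z + cdeg E k z).
  by rewrite !big_split /= !(sum_pred1 (fun=> q)).
apply: leq_sum => z _; have := @dz z; have := cz z.
have [->|nzx] := eqVneq z x.
  by rewrite (negbTE nxy) cx (symE y) Exy nxx; lia.
have [->|nzy] := eqVneq z y; first by rewrite cy Exy nxx; lia.
by move=> _ /(_ isT isT); lia.
Qed.

(** A vertex above [q] loses one edge for free, which pays for its edge of the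
    deleted color.  Hence only the edges of that color at vertices of degree at
    most [q] count; each edge has at most one such end, so this is at most half
    of [class_size]. *)
Lemma potential_high_low :
    (forall a b, E a b -> deg E a <= q -> q < deg E b) ->
    deg E y <= q ->
  potential q E <= potential q E' + (4 * q + 4 * r - 8).
Proof.
move=> noLL ly; have hx: q < deg E x by apply: (noLL y) => //; rewrite symE.
have half: 2 * \sum_z (deg E z <= q) * cdeg E k z <= class_size E k.
  rewrite mul2n -addnn.
  have ->: class_size E k = \sum_z (deg E z <= q) * cdeg E k z +
                            \sum_z (q < deg E z) * cdeg E k z.
    by rewrite -big_split; apply: eq_bigr => z _ /=; case: leqP; lia.
  rewrite leq_add2l /cdeg.
  under eq_bigr => z do rewrite big_distrr /=.
  under [leqRHS]eq_bigr => z do rewrite big_distrr /=.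
  rewrite exchange_big; apply: leq_sum => w _; apply: leq_sum => z _.
  case: (cgE) => _ _ symc _; rewrite (symc z) (symE z).
  case Ewz: (E w z); rewrite /= ?muln0 //; case: (_ == k); rewrite ?muln0 //.
  have := noLL z w; rewrite symE Ewz => /(_ isT).
  by case: (leqP (deg E z) q) => // _ ->.
suff: potential q E + 1 + 2 <= potential q E' + q + q + deg E x + deg E y
         + \sum_z (deg E z <= q) * cdeg E k z.
  have := class_le k; have := deg_le x; lia.
have ->: potential q E + 1 + 2 =
         \sum_z (minn (deg E z) q + (z == x) * 1 + (z == y) * 2).
  by rewrite !big_split /= (sum_pred1 (fun=> 1)) (sum_pred1 (fun=> 2)).
have ->: potential q E' + q + q + deg E x + deg E y
           + \sum_z (deg E z <= q) * cdeg E k z =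
         \sum_z (minn (deg E' z) q + (z == x) * q + (z == y) * q
                + E x z + E y z + (deg E z <= q) * cdeg E k z).
  by rewrite !big_split /= !(sum_pred1 (fun=> q)).
apply: leq_sum => z _; have := @dz z; have := cz z.
have [->|nzx] := eqVneq z x.
  by rewrite (negbTE nxy) cx (symE y) Exy nxx; lia.
have [->|nzy] := eqVneq z y; first by rewrite cy Exy nxx ly; lia.
move=> ? /(_ isT isT); case: (leqP (deg E z) q) => /=; lia.
Qed.

(** The vertices of degree at most [q] are isolated, and the others pay nothing
    for the deleted color. *)
Lemma potential_high_high :
    (forall a b, E a b -> q < deg E a) ->
  potential q E <= potential q E' + (4 * q + 4 * r - 8).
Proof.
move=> allH.
have lx := deg_le x; have ly := deg_le y.
suff: potential q E + 1 + 1 <= potential q E' + q + q + deg E x + deg E y by lia.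
have ->: potential q E + 1 + 1 =
         \sum_z (minn (deg E z) q + (z == x) * 1 + (z == y) * 1).
  by rewrite !big_split /= !(sum_pred1 (fun=> 1)).
have ->: potential q E' + q + q + deg E x + deg E y =
         \sum_z (minn (deg E' z) q + (z == x) * q + (z == y) * q
                + E x z + E y z).
  by rewrite !big_split /= !(sum_pred1 (fun=> q)).
apply: leq_sum => z _; have := @dz z; have := cz z.
have [->|nzx] := eqVneq z x.
  by rewrite (negbTE nxy) (symE y) Exy nxx; lia.
have [->|nzy] := eqVneq z y; first by rewrite Exy nxx; lia.
move=> ? /(_ isT isT); case: (leqP (deg E z) q) => [lz|]; last by lia.
suff ->: deg E z = 0 by lia.
apply: big1 => w _; case Ezw: (E z w) => //; have := allH z w Ezw; lia.
Qed.

End DelEdge.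

(** * Extending rainbow matchings *)

Definition ends l : seq V := map fst l ++ map snd l.

Definition colors l : seq nat := [seq c p.1 p.2 | p <- l].

Definition rainbow E l :=
  [&& all (fun p => E p.1 p.2) l, uniq (ends l) & uniq (colors l)].

Definition compatible E l x y :=
  [&& E x y, x \notin ends l, y \notin ends l & c x y \notin colors l].

Lemma size_ends l : size (ends l) = 2 * size l.
Proof. by rewrite size_cat !size_map mul2n addnn. Qed.

Lemma endsP E l v : v \in ends l -> all (fun p => E p.1 p.2) l ->
  symmetric E -> exists w, E v w.
Proof.
move=> vl /allP El symE; move: vl; rewrite mem_cat.
by case/orP=> /mapP[p /El Ep ->]; [exists p.2 | exists p.1; rewrite symE].
Qed.

(** At least 3r-2 edges leave [v], where r-1 is the size of [l].  At most 2r-2 of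
    them end in [l], and at most r-1 have a color of [l]. *)
Lemma rainbow_extend_vertex E E' v l :
    colored_graph E -> del_vertex E E' v -> 3 * (size l).+1 <= deg E v + 2 ->
  rainbow E' l -> exists x y, compatible E l x y.
Proof.
move=> cgE dE big /and3P[El _ _].
have cgE' := del_vertex_colored cgE dE.
have vl: v \notin ends l.
  apply/negP=> vl; case: cgE' => symE' _ _ _.
  by have [w] := endsP vl El symE'; rewrite dE eqxx andbF.
have [/existsP[w ?]|] := boolP [exists w, compatible E l v w]; first by exists v, w.
rewrite negb_exists => /forallP none.
have: deg E v <= \sum_w (w \in ends l) + \sum_w (E v w && (c v w \in colors l)).
  rewrite -big_split; apply: leq_sum => w _ /=; have := none w.
  rewrite /compatible vl; case: (E v w) => //=.
  by case: (w \in ends l) => //=; case: (c v w \in _).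
have := sum_mem (ends l); rewrite size_ends.
have: \sum_w (E v w && (c v w \in colors l)) <= size (colors l).
  by apply: sum_mem_inj => a b Ea Eb; case: cgE => _ _ _; apply.
rewrite size_map; lia.
Qed.

(** Each vertex of [l] lies on at most one edge of color [k], so [l] meets at most
    2r-2 of the 2r-1 edges; all counts are doubled, as in [class_size]. *)
Lemma rainbow_extend_color E E' k l :
    colored_graph E -> del_color E E' k -> 4 * (size l).+1 <= class_size E k + 2 ->
  rainbow E' l -> exists x y, compatible E l x y.
Proof.
move=> cgE dE big /and3P[El _ _].
have kl: k \notin colors l.
  by apply/negP=> /mapP[p /(allP El)]; rewrite dE => /andP[_ /eqP + /esym].
have [/existsP[x /existsP[y ?]]|] :=
  boolP [exists x, exists y, compatible E l x y]; first by exists x, y.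
rewrite negb_exists => /forallP none.
have half: \sum_u (u \in ends l) * cdeg E k u <= 2 * size l.
  rewrite -size_ends; apply: leq_trans (sum_mem _); apply: leq_sum => u _.
  by case: (u \in ends l); rewrite ?mul1n ?mul0n // cdeg_le1.
have swap: \sum_u (u \in ends l) * cdeg E k u =
           \sum_u \sum_w (w \in ends l) * (E u w && (c u w == k)).
  rewrite exchange_big; apply: eq_bigr => w _; rewrite /cdeg big_distrr.
  by apply: eq_bigr => u _ /=; case: cgE => symE _ symc _; rewrite symE symc.
have: class_size E k <= \sum_u (u \in ends l) * cdeg E k u +
                        \sum_u \sum_w (w \in ends l) * (E u w && (c u w == k)).
  rewrite -big_split; apply: leq_sum => u _ /=.
  rewrite /cdeg big_distrr -big_split; apply: leq_sum => w _ /=.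
  have := none u; rewrite negb_exists => /forallP/(_ w); rewrite /compatible.
  case: (E u w) => //=; have [->|//] := eqVneq (c u w) k; rewrite kl.
  by case: (u \in _); case: (w \in _).
by rewrite -swap; lia.
Qed.

Lemma rainbow_extend_edge E E' x y l :
    colored_graph E -> del_edge E E' x y -> E x y ->
  rainbow E' l -> compatible E l x y.
Proof.
move=> cgE dE Exy /and3P[El _ _].
have cgE' := del_edge_colored cgE dE; case: (cgE') => symE' _ _ _.
rewrite /compatible Exy /=; apply/and3P; split.
- by apply/negP=> vl; have [w] := endsP vl El symE'; rewrite dE eqxx andbF.
- by apply/negP=> vl; have [w] := endsP vl El symE'; rewrite dE eqxx !andbF.
- apply/negP=> /mapP[p /(allP El)]; rewrite dE.
  by case/and5P=> _ _ _ _ /andP[_ /eqP + /esym].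
Qed.

(** * The invariant of the first phase *)

(** The sum of the costs 4q+4j-8 of the levels j = 2, ..., r. *)
Definition threshold q r := (r - 1) * (4 * q + 2 * r - 4).

(** The second case is the time before an edge is picked, when [q] still follows
    [r] and [m + r] vertices, where [m] stands for n-d, have degree at least
    [r]; the third is the time after. *)
Definition stage_ok m q r E :=
  [\/ r = 0,
      q = r /\ m + r <= \sum_v (r <= deg E v)
    | [/\ r < q, forall v, deg E v <= 3 * q - 3,
          forall k, class_size E k <= 4 * q - 4
        & threshold q r < potential q E]].

(** After something is set aside, [q] goes down with [r], unless an edge has been
    picked, in which case [r < q]. *)
Definition next_cap q r := q - (q == r).

Lemma potential_card q E : q * \sum_v (q <= deg E v) <= potential q E.
Proof.
rewrite big_distrr; apply: leq_sum => v _ /=.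
by case qE: (q <= deg E v); rewrite ?muln1 ?muln0; lia.
Qed.

(** The hypothesis on [d] passes to every [r <= d]: multiplied by [d], the wanted
    inequality follows from [r] times the given one, with a slack of
    (d-r)(5rd-4). *)
Lemma stage_potential m d q r E :
    0 < r <= d -> (d - 1) * (6 * d - 4) < d * (m + d) ->
  stage_ok m q r E -> r <= q /\ threshold q r < potential q E.
Proof.
move=> /andP[r0 rd] big [|[-> many]|[/ltnW rq _ _ Phi]] //; first lia.
split=> //; apply: leq_trans (potential_card r E); rewrite /threshold.
suff: (r - 1) * (6 * r - 4) < r * (m + r).
  have ->: 4 * r + 2 * r - 4 = 6 * r - 4 by lia.
  by move=> h; apply: leq_trans h _; rewrite leq_mul2l many orbT.
have [r' rE] : exists r', r = r'.+1 by exists r.-1; lia.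
have [e dE] : exists e, d = r + e by exists (d - r); lia.
suff: d * ((r - 1) * (6 * r - 4)) < d * (r * (m + r)) by rewrite ltn_pmul2l; lia.
move: big; rewrite dE rE.
have -> : (r'.+1 - 1) * (6 * r'.+1 - 4) = r' * (6 * r' + 2) by congr muln; lia.
have -> : (r'.+1 + e - 1) * (6 * (r'.+1 + e) - 4) = (r' + e) * (6 * (r' + e) + 2).
  by congr muln; lia.
nia.
Qed.

Lemma potential_edge q E : 0 < potential q E -> exists x y, E x y.
Proof.
have [/existsP[x /existsP[y ?]] _|] := boolP [exists x, exists y, E x y].
  by exists x, y.
rewrite negb_exists => /forallP none; rewrite /potential big1 // => v _.
rewrite /deg big1 ?min0n // => w _.
by have := none v; rewrite negb_exists => /forallP/(_ w)/negbTE ->.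
Qed.

Lemma stage_del_vertex m q r E E' v :
    colored_graph E -> 0 < r -> 3 * r <= deg E v + 2 ->
    del_vertex E E' v -> stage_ok m q r E ->
  stage_ok m (next_cap q r) (r - 1) E'.
Proof.
move=> cgE r0 big dE; have sub: subrel E' E by move=> a b; rewrite dE => /andP[].
have [->|r1] := eqVneq r 1; first by constructor 1.
case=> [rE|[-> many]|[rq dle cle Phi]]; first lia.
- constructor 2; rewrite /next_cap eqxx; split=> //.
  suff: \sum_z (r <= deg E z) <= \sum_z (r - 1 <= deg E' z) + \sum_z (z == v) * 1.
    by rewrite (sum_pred1 (fun=> 1)); lia.
  rewrite -big_split; apply: leq_sum => z _ /=.
  have [->|nzv] := eqVneq z v; first by case: (r <= _); lia.
  have := deg_del_vertex dE nzv; have := leq_b1 (E z v); lia.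
constructor 3; rewrite /next_cap gtn_eqF // subn0; split; first lia.
- by move=> z; apply: leq_trans (dle z); apply: sub_deg.
- by move=> k; apply: leq_trans (cle k); apply: sub_class_size.
have := potential_del_vertex q (let: And4 s _ _ _ := cgE in s) dE.
have := dle v; move: Phi; rewrite /threshold.
have [r' ->] : exists r', r = r'.+2 by exists (r - 2); lia.
rewrite !subSS !subn0; nia.
Qed.

Lemma stage_del_color m q r E E' k :
    colored_graph E -> 0 < r ->
    del_color E E' k -> stage_ok m q r E ->
  stage_ok m (next_cap q r) (r - 1) E'.
Proof.
move=> cgE r0 dE; have sub: subrel E' E by move=> a b; rewrite dE => /andP[].
have [->|r1] := eqVneq r 1; first by constructor 1.
case=> [rE|[-> many]|[rq dle cle Phi]]; first lia.
- constructor 2; rewrite /next_cap eqxx; split=> //.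
  suff: \sum_z (r <= deg E z) <= \sum_z (r - 1 <= deg E' z) by lia.
  apply: leq_sum => z _; have := deg_del_color z dE; have := cdeg_le1 k z cgE; lia.
constructor 3; rewrite /next_cap gtn_eqF // subn0; split; first lia.
- by move=> z; apply: leq_trans (dle z); apply: sub_deg.
- by move=> j; apply: leq_trans (cle j); apply: sub_class_size.
have := potential_del_color q dE.
have := cle k; move: Phi; rewrite /threshold.
have [r' ->] : exists r', r = r'.+2 by exists (r - 2); lia.
rewrite !subSS !subn0; nia.
Qed.

Lemma stage_del_edge m d q r E E' x y :
    colored_graph E -> 0 < r <= d -> (d - 1) * (6 * d - 4) < d * (m + d) ->
    (forall v, deg E v <= 3 * r - 3) -> (forall k, class_size E k <= 4 * r - 4) ->
    E x y ->
    (forall a b, E a b ->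
       (q < deg E x) + (q < deg E y) <= (q < deg E a) + (q < deg E b)) ->
    del_edge E E' x y -> stage_ok m q r E ->
  stage_ok m q (r - 1) E'.
Proof.
move=> cgE rd big dle cle Exy best dE ok.
have [rq Phi] := stage_potential rd big ok.
have sub: subrel E' E by move=> a b; rewrite dE => /andP[].
have [->|r1] := eqVneq r 1; first by constructor 1.
have {}r1 : 1 < r by lia.
constructor 3; split; first lia.
- by move=> z; have := dle z; have := sub_deg z sub; lia.
- by move=> j; have := cle j; have := sub_class_size j sub; lia.
suff: potential q E <= potential q E' + (4 * q + 4 * r - 8).
  move: Phi; rewrite /threshold.
  have [r' ->] : exists r', r = r'.+2 by exists (r - 2); lia.
  rewrite !subSS !subn0; nia.
case: (cgE) => symE _ symc _.
have dE' : del_edge E E' y x.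
  move=> a b; rewrite dE (symc y).
  by do 5![case: (_ == _); rewrite ?andbF //=].
have Eyx : E y x by rewrite symE.
case: (leqP (deg E x) q) (leqP (deg E y) q) => [lx|hx] [ly|hy].
- exact: (potential_low_low cgE Exy dE).
- apply: (potential_high_low cgE Eyx dE') => // a b Eab la.
  have := best a b Eab; lia.
- apply: (potential_high_low cgE Exy dE) => // a b Eab la.
  have := best a b Eab; lia.
apply: (potential_high_high cgE Exy dE) => // a b Eab.
have := best a b Eab; lia.
Qed.

End Rainbow.

(** * Program logic *)

Section Logic.

Variable B : nat.

Definition bounded (s : state) :=
  (forall x, vars s x <= B) /\ (forall a i, arrs s a i <= B).

(** A bound on the value of [e] in all states bounded by [B], read off the text
    of [e]; quotients, remainders and differences are bounded by their first
    argument. *)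
Fixpoint ebound (e : expr) : nat :=
  match e with
  | ECst k => k
  | EVar _ | EArr _ _ => B
  | EBin OpAdd e1 e2 => ebound e1 + ebound e2
  | EBin OpMul e1 e2 => ebound e1 * ebound e2
  | EBin (OpEq | OpLt) _ _ => 1
  | EBin _ e1 _ => ebound e1
  end.

Fixpoint efits (W : nat) (e : expr) : bool :=
  (ebound e <= W) &&
  match e with
  | ECst _ | EVar _ => true
  | EArr _ i => efits W i
  | EBin _ e1 e2 => efits W e1 && efits W e2
  end.

Fixpoint cfits (W : nat) (c : cmd) : bool :=
  match c with
  | CSkip => true
  | CSet _ e => efits W e
  | CPut _ i e => efits W i && efits W e
  | CSeq c1 c2 => cfits W c1 && cfits W c2
  | CIf e c1 c2 => [&& efits W e, cfits W c1 & cfits W c2]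
  | CWhile e c => efits W e && cfits W c
  end.

Lemma eval_ebound s e : bounded s -> eval s e <= ebound e.
Proof.
move=> [bv ba]; elim: e => //= o e1 IH1 e2 IH2.
case: o => /=; [exact: leq_add | | exact: leq_mul | | | exact: leq_b1 | exact: leq_b1].
- exact: leq_trans (leq_subr _ _) IH1.
- exact: leq_trans (leq_div _ _) IH1.
- exact: leq_trans (leq_mod _ _) IH1.
Qed.

Lemma efits_fits W s e : bounded s -> efits W e -> fits W s e.
Proof.
move=> bs; elim: e => [k|x|a i IH|o e1 IH1 e2 IH2] /=;
  move=> /andP[le_W]; rewrite (leq_trans _ le_W) //.
- by rewrite (proj1 bs).
- by rewrite (proj2 bs).
- by move=> /andP[/IH1-> /IH2->].
exact: (@eval_ebound s (EBin o e1 e2)).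
Qed.

(** The word bound [W] and the boundedness of the initial state are built in, so
    that overflow does not appear in later specifications; what is left of it is
    the bound on each assigned value in [wp]. *)
Definition runs (c : cmd) (T : nat) (Q : state -> Prop) (s : state) :=
  forall W, cfits W c -> bounded s ->
  exists t s', [/\ exec W c s t s', t <= T, bounded s' & Q s'].

Lemma runs_weaken c T T' (Q Q' : state -> Prop) s :
  T <= T' -> (forall s', Q s' -> Q' s') -> runs c T Q s -> runs c T' Q' s.
Proof.
move=> le_T sub run W fW bs; have [t [s' [ex le_t bs' Qs']]] := run W fW bs.
by exists t, s'; split=> //; [apply: leq_trans le_T | apply: sub].
Qed.

Lemma runs_seq c1 c2 T1 T2 Q s :
  runs c1 T1 (runs c2 T2 Q) s -> runs (CSeq c1 c2) (T1 + T2) Q s.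
Proof.
move=> run1 W /= /andP[f1 f2] bs.
have [t1 [s1 [ex1 le1 bs1 run2]]] := run1 W f1 bs.
have [t2 [s2 [ex2 le2 bs2 Qs2]]] := run2 W f2 bs1.
by exists (t1 + t2), s2; split=> //; [apply: ExSeq ex2 | apply: leq_add].
Qed.

Lemma runs_then c1 c2 T1 T2 (Q1 Q : state -> Prop) s :
    runs c1 T1 Q1 s -> (forall s1, Q1 s1 -> runs c2 T2 Q s1) ->
  runs (CSeq c1 c2) (T1 + T2) Q s.
Proof. by move=> run1 run2; apply: runs_seq; apply: runs_weaken run1. Qed.

(** The invariant is indexed by the number of rounds done, so that the number of
    rounds, and thereby the running time, is part of the proof. *)
Lemma runs_while e c T (I : nat -> state -> Prop) N s :
    (forall k s1, k < N -> I k s1 -> eval s1 e != 0 /\ runs c T (I k.+1) s1) ->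
    (forall s1, I N s1 -> eval s1 e = 0) ->
    I 0 s ->
  runs (CWhile e c) (N * (ecost e + T).+1 + (ecost e).+1) (I N) s.
Proof.
move=> step stop I0 W fW bs; have /= /andP[fe fc] := fW.
suff loop M : forall k s1, N = k + M -> I k s1 -> bounded s1 ->
    exists t s', [/\ exec W (CWhile e c) s1 t s',
      t <= M * (ecost e + T).+1 + (ecost e).+1, bounded s' & I N s'].
  exact: (loop N 0 s).
elim: M => [|M IH] k s1 NE Ik bs1.
  rewrite addn0 in NE; rewrite -NE in Ik.
  exists (ecost e).+1, s1; split=> //.
  by apply: ExWhileF; [apply: efits_fits | apply: stop].
have [e0 run] : eval s1 e != 0 /\ runs c T (I k.+1) s1 by apply: step => //; lia.
have [t1 [s2 [ex1 le1 bs2 Ik1]]] := run W fc bs1.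
have [|t2 [s3 [ex2 le2 bs3 QN]]] := IH k.+1 s2 _ Ik1 bs2; first by lia.
exists (ecost e + t1 + t2).+1, s3; split=> //; last by rewrite mulSn; lia.
by apply: ExWhileT ex2 => //; apply: efits_fits.
Qed.

(** Only loop-free programs have a weakest precondition here. *)
Fixpoint wp (c : cmd) (Q : state -> Prop) (s : state) : Prop :=
  match c with
  | CSkip => Q s
  | CSet x e => eval s e <= B /\ Q (set_var s x (eval s e))
  | CPut a i e => eval s e <= B /\ Q (set_arr s a (eval s i) (eval s e))
  | CSeq c1 c2 => wp c1 (wp c2 Q) s
  | CIf e c1 c2 => if eval s e != 0 then wp c1 Q s else wp c2 Q s
  | CWhile _ _ => False
  end.

Fixpoint tcost (c : cmd) : nat :=
  match c with
  | CSkip | CWhile _ _ => 1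
  | CSet _ e => (ecost e).+1
  | CPut _ i e => (ecost i + ecost e).+1
  | CSeq c1 c2 => tcost c1 + tcost c2
  | CIf e c1 c2 => (ecost e + maxn (tcost c1) (tcost c2)).+1
  end.

Lemma runs_wp c Q s : wp c Q s -> runs c (tcost c) Q s.
Proof.
move=> wpc W; elim: c Q s wpc => [|x e|a i e|c1 IH1 c2 IH2|e c1 IH1 c2 IH2|//] Q s /=.
- by move=> Qs _ bs; exists 1, s; split=> //; apply: ExSkip.
- move=> [le_B Qs] fe bs; exists (ecost e).+1, (set_var s x (eval s e)); split=> //.
    by apply: ExSet; apply: efits_fits.
  by split=> [y|//] /=; [case: eqP => _; case: bs | case: bs].
- move=> [le_B Qs] /andP[fi fe] bs.
  exists (ecost i + ecost e).+1, (set_arr s a (eval s i) (eval s e)); split=> //.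
    by apply: ExPut; apply: efits_fits.
  by split=> [y|b j] /=; [case: bs | case: (_ && _); case: bs].
- move=> wp1 /andP[f1 f2] bs.
  have [t1 [s1 [ex1 le1 bs1 wp2]]] := IH1 _ _ wp1 f1 bs.
  have [t2 [s2 [ex2 le2 bs2 Qs2]]] := IH2 _ _ wp2 f2 bs1.
  by exists (t1 + t2), s2; split=> //; [apply: ExSeq ex2 | apply: leq_add].
case e0: (eval s e != 0) => wpc /and3P[fe f1 f2] bs.
  have [t [s' [ex le_t bs' Qs']]] := IH1 _ _ wpc f1 bs.
  exists (ecost e + t).+1, s'; split=> //; last by rewrite ltnS leq_add2l leq_max le_t.
  by apply: ExIfT => //; apply: efits_fits.
have [t [s' [ex le_t bs' Qs']]] := IH2 _ _ wpc f2 bs.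
exists (ecost e + t).+1, s'; split=> //.
  by apply: ExIfF => //; [apply: efits_fits | apply/eqP; rewrite -[_ == _]negbK e0].
by rewrite ltnS leq_add2l leq_max le_t orbT.
Qed.

End Logic.

Lemma runs_bounded B c T Q s : (bounded B s -> runs B c T Q s) -> runs B c T Q s.
Proof. by move=> run W fW bs; apply: run. Qed.

(** Agreement on the first [nv] variables and the first [na] arrays; as the
    scratch variables and arrays have the largest names, this is the frame
    condition of every scan. *)
Definition agree (nv na : nat) (s0 s : state) :=
  (forall x, x < nv -> vars s x = vars s0 x) /\
  (forall a i, a < na -> arrs s a i = arrs s0 a i).

Lemma agree_trans nv na s1 s2 s3 :
  agree nv na s1 s2 -> agree nv na s2 s3 -> agree nv na s1 s3.
Proof.
move=> [v12 a12] [v23 a23]; split=> [x lx|a i la]; first by rewrite v23 ?v12.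
by rewrite a23 ?a12.
Qed.

Lemma agree_le nv nv' na s1 s2 :
  nv' <= nv -> agree nv na s1 s2 -> agree nv' na s1 s2.
Proof. by move=> le [v12 a12]; split=> // x lx; apply: v12; apply: leq_trans le. Qed.

Lemma agree_set_var nv na s0 s x k :
  nv <= x -> agree nv na s0 s -> agree nv na s0 (set_var s x k).
Proof.
move=> lex [v a]; split=> // y ly; rewrite /= ifF ?v //.
by apply: ltn_eqF; apply: leq_trans lex.
Qed.

Lemma agree_set_arr nv na s0 s b j k :
  na <= b -> agree nv na s0 s -> agree nv na s0 (set_arr s b j k).
Proof.
move=> leb [v a]; split=> // c i lc; rewrite /= ifF ?a //.
by apply/negP=> /andP[/eqP cb _]; move: lc; rewrite cb ltnNge leb.
Qed.

Fixpoint writes_above (nv na : nat) (c : cmd) : bool :=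
  match c with
  | CSkip => true
  | CSet x _ => nv <= x
  | CPut a _ _ => na <= a
  | CSeq c1 c2 | CIf _ c1 c2 => writes_above nv na c1 && writes_above nv na c2
  | CWhile _ c => writes_above nv na c
  end.


Lemma wp_mono B c (Q Q' : state -> Prop) s :
  (forall s', Q s' -> Q' s') -> wp B c Q s -> wp B c Q' s.
Proof.
elim: c Q Q' s => [|x e|a i e|c1 IH1 c2 IH2|e c1 IH1 c2 IH2|//] Q Q' s sub /=.
- exact: sub.
- by case=> le_B /sub.
- by case=> le_B /sub.
- by apply: IH1 => s'; apply: IH2.
- by case: ifP => _; [apply: IH1 | apply: IH2].
Qed.

Lemma wp_agree B nv na c Q s0 s :
    agree nv na s0 s -> writes_above nv na c -> wp B c Q s ->
  wp B c (fun s' => agree nv na s0 s' /\ Q s') s.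
Proof.
elim: c Q s => [|x e|a i e|c1 IH1 c2 IH2|e c1 IH1 c2 IH2|//] Q s /= ag.
- by [].
- by move=> w [le_B Qs]; split=> //; split=> //; apply: agree_set_var.
- by move=> w [le_B Qs]; split=> //; split=> //; apply: agree_set_arr.
- move=> /andP[w1 w2] wp1; apply: wp_mono (IH1 _ _ ag w1 wp1) => s1 [ag1].
  exact: IH2.
- by move=> /andP[w1 w2]; case: ifP => _; [apply: IH1 | apply: IH2].
Qed.

Lemma wp_if B e (b : bool) c1 c2 Q s : eval s e = b ->
  (if b then wp B c1 Q s else wp B c2 Q s) -> wp B (CIf e c1 c2) Q s.
Proof. by rewrite /= => ->; case: b. Qed.

(** * Scanning the adjacency matrix *)

Definition EAdd := EBin OpAdd.
Definition ESub := EBin OpSub.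
Definition EMul := EBin OpMul.
Definition EDiv := EBin OpDiv.
Definition EMod := EBin OpMod.
Definition ELt := EBin OpLt.
Definition EEq := EBin OpEq.

(** Variables: the input order [vn], the number [vm] of edges listed so far, the
    square [vN] of the order, the target size [vd], the level [vr], the cap [vq]
    of the potential; the position [vk] of a scan with its row [vi], column [vj]
    and matrix entry [vv]; the best value [vb] so far and its row, column and
    entry. *)
Definition vn := 0.
Definition vm := 1.
Definition vN := 2.
Definition vd := 3.
Definition vr := 4.
Definition vq := 5.
Definition vk := 6.
Definition vi := 7.
Definition vj := 8.
Definition vv := 9.
Definition vb := 10.
Definition vbi := 11.
Definition vbj := 12.
Definition vbv := 13.

(** Arrays: the input, the output, the stamps of the vertices, the stamps of the
    colors, the live degrees, and the number of live edges of each color; a color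
    is represented by its matrix entry, which is the color plus 1. *)
Definition amat := 0.
Definition aout := 1.
Definition aD := 2.
Definition aC := 3.
Definition adeg := 4.
Definition acnt := 5.

(** A scan is a single loop over the n^2 cells; row and column are recovered by
    division. *)
Definition scan_body (body : cmd) : cmd :=
  CSeq (CSet vi (EDiv (EVar vk) (EVar vn)))
 (CSeq (CSet vj (EMod (EVar vk) (EVar vn)))
 (CSeq (CSet vv (EArr amat (EVar vk)))
 (CSeq body
       (CSet vk (EAdd (EVar vk) (ECst 1)))))).

Definition scan (body : cmd) : cmd :=
  CSeq (CSet vk (ECst 0))
       (CWhile (ELt (EVar vk) (EVar vN)) (scan_body body)).

Definition scan_cost (n : nat) (body : cmd) : nat :=
  2 + (n * n * (4 + tcost (scan_body body)) + 4).

(** The body may only write to scratch variables and arrays; therefore the frame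
    [agree] comes for free, and the invariant [I] need only describe what the body
    computes. *)
Lemma runs_scan B body (I : nat -> state -> Prop) (s0 : state) n :
    vars s0 vn = n -> vars s0 vN = n * n -> writes_above vb adeg body ->
    (forall k s x u, x \in [:: vk; vi; vj; vv] -> I k s -> I k (set_var s x u)) ->
    (forall k s, k < n * n -> agree vk adeg s0 s ->
       vars s vk = k -> vars s vi = k %/ n -> vars s vj = k %% n ->
       vars s vv = arrs s0 amat k -> I k s -> wp B body (I k.+1) s) ->
    I 0 s0 ->
  runs B (scan body) (scan_cost n body)
    (fun s => agree vk adeg s0 s /\ I (n * n) s) s0.
Proof.
move=> n0 N0 wb frame step I0; apply: runs_bounded => -[bv ba].
apply: runs_seq; apply: runs_wp; split=> //=; set s1 := set_var _ _ _.
pose J k s := [/\ agree vk adeg s0 s, vars s vk = k & I k s].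
have J0 : J 0 s1.
  by split=> //; [apply: agree_set_var | apply: frame].
apply: runs_weaken
  (runs_while (T := tcost (scan_body body)) (I := J) (N := n * n) _ _ J0).
- by [].
- by move=> s [].
- move=> k s lt_k [ag sk Ik].
  have sn : vars s vn = n by rewrite (proj1 ag).
  have sN : vars s vN = n * n by rewrite (proj1 ag).
  have kB : k < B by apply: leq_trans lt_k _; rewrite -N0.
  split; first by rewrite /= sk sN lt_k.
  apply: runs_wp => /=; rewrite sk sn.
  rewrite (proj2 ag) //; split; first by apply: leq_trans (leq_div _ _) (ltnW kB).
  split; first by apply: leq_trans (leq_mod _ _) (ltnW kB).
  split; first exact: ba.
  set s2 := set_var _ _ _.
  have ag2 : agree vk adeg s0 s2 by do 3![apply: agree_set_var => //].
  have I2 : I k s2 by do 3![apply: (@frame) => //].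
  have w := step k s2 lt_k ag2 sk erefl erefl erefl I2.
  have ag2' : agree vb adeg s2 s2 by [].
  apply: wp_mono (wp_agree ag2' wb w) => s3 [ag3 I3] /=.
  have sk3 : vars s3 vk = k by rewrite (proj1 ag3).
  rewrite sk3 addn1; split=> //; split=> //.
    by apply: agree_set_var => //; apply: agree_trans ag2 (agree_le _ ag3).
  exact: frame.
by move=> s [ag sk _]; rewrite /= sk (proj1 ag) // N0 ltnn.
Qed.

Section Scans.

Variables (n : nat) (G : sgraph n) (col : {set 'I_n} -> nat).

Definition cl (u v : 'I_n) : nat := col [set u; v].

Definition mat (k : nat) : nat := matrix_entry G col (k %/ n) (k %% n).

Definition idx (u v : 'I_n) : nat := u * n + v.

(** The edges whose stamps are all below [L]: level [r] corresponds to
    [L = r + 1], and since a stamp 0 means that nothing was deleted, [L = 1] gives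
    the edges alive at the moment. *)
Definition live (D C : nat -> nat) (L : nat) : rel 'I_n :=
  fun u v => [&& adj G u v, D u < L, D v < L & C (cl u v).+1 < L].

Definition live_at (D C : nat -> nat) (L k : nat) : bool :=
  [&& 0 < mat k, D (k %/ n) < L, D (k %% n) < L & C (mat k) < L].

Lemma cl_sym u v : cl u v = cl v u.
Proof. by rewrite /cl setUC. Qed.

Lemma live_sym D C L : symmetric (live D C L).
Proof. by move=> u v; rewrite /live adj_sym cl_sym (andbCA (D u < L)). Qed.

Lemma idx_div u v : idx u v %/ n = u.
Proof.
by rewrite /idx divnMDl ?divn_small ?addn0 //; apply: leq_ltn_trans (ltn_ord u).
Qed.

Lemma idx_mod u v : idx u v %% n = v.
Proof. by rewrite /idx modnMDl modn_small. Qed.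

Lemma idx_lt u v : idx u v < n * n.
Proof. have := ltn_ord u; have := ltn_ord v; rewrite /idx; nia. Qed.

Lemma idx_surj k : k < n * n -> exists u v, k = idx u v.
Proof.
move=> lt_k; have n_gt0 : 0 < n by case: n lt_k.
have lt_d : k %/ n < n by rewrite ltn_divLR.
have lt_m : k %% n < n by rewrite ltn_mod.
by exists (Ordinal lt_d), (Ordinal lt_m); rewrite /idx /= -divn_eq.
Qed.

Lemma mat_idx u v : mat (idx u v) = if adj G u v then (cl u v).+1 else 0.
Proof. by rewrite /mat idx_div idx_mod /matrix_entry !valK. Qed.

Lemma live_at_idx D C L u v : live_at D C L (idx u v) = live D C L u v.
Proof.
by rewrite /live_at mat_idx idx_div idx_mod /live; case: (adj G u v).
Qed.

Lemma sum_idx (F : nat -> nat) :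
  \sum_(0 <= k < n * n) F k = \sum_u \sum_v F (idx u v).
Proof.
(* The number of rows is generalized, the length of a row is not. *)
suff gen m : \sum_(0 <= k < m * n) F k =
             \sum_(0 <= i < m) \sum_(0 <= j < n) F (i * n + j).
  by rewrite gen big_mkord; apply: eq_bigr => i _; rewrite big_mkord.
elim: m => [|m IH]; first by rewrite mul0n !big_geq.
rewrite big_nat_recr //= -IH mulSn (big_cat_nat (n := m * n)) ?leq_addl //=.
have := big_addn 0 (n + m * n) (m * n) xpredT F; rewrite add0n addnK => ->.
by congr addn; apply: eq_bigr => j _; rewrite addnC.
Qed.

Lemma mat_le k : mat k <= (max_color G col).+1.
Proof.
rewrite /mat /matrix_entry; case: insub => // u; case: insub => // v.
case Auv: (adj G u v) => //; rewrite ltnS /max_color.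
apply: (leq_bigmax_cond (F := col)); apply/imset2P.
by exists u v => //; rewrite !inE.
Qed.

Definition at_arr (a x : nat) : expr := EArr a (EVar x).

(** A product of truth values serves as conjunction. *)
Definition alive_test (lvl : expr) : expr :=
  EMul (ELt (ECst 0) (EVar vv))
 (EMul (ELt (at_arr aD vi) lvl)
 (EMul (ELt (at_arr aD vj) lvl) (ELt (at_arr aC vv) lvl))).

Definition zero_body : cmd :=
  CSeq (CPut adeg (EVar vi) (ECst 0)) (CPut acnt (EVar vv) (ECst 0)).

Definition count_body : cmd :=
  CIf (alive_test (ECst 1))
    (CSeq (CPut adeg (EVar vi) (EAdd (at_arr adeg vi) (ECst 1)))
          (CPut acnt (EVar vv)
             (EAdd (at_arr acnt vv) (ELt (EVar vi) (EVar vj)))))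
    CSkip.

Definition min_body : cmd :=
  CIf (ELt (at_arr adeg vi) (EVar vb)) (CSet vb (at_arr adeg vi)) CSkip.

(** The three criteria in order of priority, packed in one number: above 15 the
    row can be set aside as a vertex, above 7 the color can be set aside, and
    otherwise edges with few ends of degree above [q] score best.  Both tests add
    a constant on the right to avoid truncated subtraction.  The score of a live
    edge is positive. *)
Definition score_expr : expr :=
  ESub (ESub (EAdd (EAdd
    (EMul (ECst 16) (ELt (EMul (ECst 3) (EVar vr)) (EAdd (at_arr adeg vi) (ECst 3))))
    (EMul (ECst 8) (ELt (EMul (ECst 2) (EVar vr)) (EAdd (at_arr acnt vv) (ECst 2)))))
    (ECst 4))
    (ELt (EVar vq) (at_arr adeg vi)))
    (ELt (EVar vq) (at_arr adeg vj)).

Definition keep_pair : cmd :=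
  CSeq (CSet vbi (EVar vi)) (CSeq (CSet vbj (EVar vj)) (CSet vbv (EVar vv))).

Definition best_body : cmd :=
  CIf (alive_test (ECst 1))
    (CIf (ELt (EVar vb) score_expr) (CSeq (CSet vb score_expr) keep_pair) CSkip)
    CSkip.

Definition find_body : cmd :=
  CIf (alive_test (EAdd (EVar vr) (ECst 1))) keep_pair CSkip.

Variable B : nat.

Definition ctx (s : state) :=
  [/\ vars s vn = n, vars s vN = n * n & forall k, arrs s amat k = mat k].

Lemma ctx_agree s0 s nv na : vN < nv -> 0 < na -> agree nv na s0 s -> ctx s0 -> ctx s.
Proof.
move=> lv la [av aa] [cn cN cm]; split; first by rewrite av // (leq_trans _ lv).
  by rewrite av.
by move=> k; rewrite aa.
Qed.

Definition stamps (s : state) (D C : nat -> nat) :=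
  (forall a, arrs s aD a = D a) /\ (forall a, arrs s aC a = C a).

Lemma stamps_agree s0 s nv na D C :
  aC < na -> agree nv na s0 s -> stamps s0 D C -> stamps s D C.
Proof.
move=> la [_ aa] [sD sC]; split=> a; rewrite aa //.
exact: leq_trans la.
Qed.

Lemma eval_alive s0 s D C k lvl :
    ctx s0 -> stamps s0 D C -> agree vk adeg s0 s ->
    vars s vi = k %/ n -> vars s vj = k %% n -> vars s vv = arrs s0 amat k ->
  eval s (alive_test lvl) = live_at D C (eval s lvl) k.
Proof.
move=> [_ _ cm] [sD sC] [_ aa] si sj sv.
by rewrite /= si sj sv cm !aa // !sD sC !mulnb.
Qed.

Lemma runs_zero s0 : ctx s0 ->
  runs B (scan zero_body) (scan_cost n zero_body)
    (fun s => agree vk adeg s0 s /\ forall k, k < n * n ->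
       arrs s adeg (k %/ n) = 0 /\ arrs s acnt (mat k) = 0) s0.
Proof.
move=> cs; pose I K (s : state) := forall k, k < K ->
  arrs s adeg (k %/ n) = 0 /\ arrs s acnt (mat k) = 0.
apply: (runs_scan (I := I)) => //; try by case: cs.
- move=> K s ltK ag sk si sj sv IK; split=> //; split=> // k.
  rewrite /= si sv; case: cs => _ _ ->; rewrite ltnS leq_eqVlt => /orP[/eqP->|/IK[-> ->]].
    by rewrite !eqxx.
  by split; case: ifP.
Qed.

Definition deg_upto D C K i := \sum_(0 <= k < K) (live_at D C 1 k && (k %/ n == i)).

(** Only cells above the diagonal are counted, so that each edge counts once. *)
Definition cnt_upto D C K v :=
  \sum_(0 <= k < K) (live_at D C 1 k && (mat k == v)) * (k %/ n < k %% n).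

Lemma runs_count s0 D C : ctx s0 -> stamps s0 D C -> n * n <= B ->
    (forall k, k < n * n -> arrs s0 adeg (k %/ n) = 0 /\ arrs s0 acnt (mat k) = 0) ->
  runs B (scan count_body) (scan_cost n count_body)
    (fun s => agree vk adeg s0 s /\ forall k, k < n * n ->
       arrs s adeg (k %/ n) = deg_upto D C (n * n) (k %/ n) /\
       arrs s acnt (mat k) = cnt_upto D C (n * n) (mat k)) s0.
Proof.
move=> cs st nB zero.
pose I K (s : state) := forall k, k < n * n ->
  arrs s adeg (k %/ n) = deg_upto D C K (k %/ n) /\
  arrs s acnt (mat k) = cnt_upto D C K (mat k).
have deg_le K i : deg_upto D C K i <= K.
  rewrite -[leqRHS]subn0 -[leqRHS]muln1 -sum_nat_const_nat.
  by apply: leq_sum => k _; apply: leq_b1.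
have cnt_le K i : cnt_upto D C K i <= K.
  rewrite -[leqRHS]subn0 -[leqRHS]muln1 -sum_nat_const_nat.
  by apply: leq_sum => k _; rewrite mulnb leq_b1.
apply: (runs_scan (I := I)) => //; try by case: cs.
- move=> K s ltK ag sk si sj sv IK.
  have degS i : deg_upto D C K.+1 i = deg_upto D C K i +
      (live_at D C 1 K && (K %/ n == i)) by rewrite /deg_upto big_nat_recr.
  have cntS v : cnt_upto D C K.+1 v = cnt_upto D C K v +
      (live_at D C 1 K && (mat K == v)) * (K %/ n < K %% n).
    by rewrite /cnt_upto big_nat_recr.
  apply: (wp_if (eval_alive _ cs st ag si sj sv)).
  case lK: (live_at D C 1 K) => /=; last first.
    by move=> k /IK[-> ->]; rewrite degS cntS lK /= !addn0.
  have [dK cK] := IK K ltK.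
  rewrite si sj sv; case: cs => _ _ ->; rewrite dK cK.
  split; first by have := deg_le K (K %/ n); lia.
  split; first by have := cnt_le K (mat K); have := leq_b1 (K %/ n < K %% n); lia.
  move=> k lt_k; have [dk ck] := IK k lt_k; rewrite degS cntS lK /=.
  split; rewrite eq_sym; case: eqP => [eK|_]; rewrite ?addn0 //.
    by rewrite -eK.
  by rewrite -eK mul1n.
- by move=> k /zero[-> ->]; rewrite /deg_upto /cnt_upto !big_geq.
Qed.

Lemma deg_uptoE D C (u : 'I_n) : deg_upto D C (n * n) u = deg (live D C 1) u.
Proof.
rewrite /deg_upto sum_idx (bigD1 u) //= [X in _ + X]big1 ?addn0.
  by apply: eq_bigr => v _; rewrite live_at_idx idx_div eqxx andbT.
by move=> w nwu; apply: big1 => v _; rewrite idx_div val_eqE (negbTE nwu) andbF.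
Qed.

Lemma cnt_uptoE D C k : 2 * cnt_upto D C (n * n) k.+1 = class_size cl (live D C 1) k.
Proof.
rewrite /cnt_upto sum_idx mul2n -addnn {2}exchange_big -big_split.
apply: eq_bigr => u _; rewrite -big_split; apply: eq_bigr => v _ /=.
rewrite !live_at_idx !mat_idx !idx_div !idx_mod.
rewrite (adj_sym G v u) (cl_sym v u) (live_sym D C 1 v u).
case: (live D C 1 u v) / boolP => //= /and4P[Auv _ _ _]; rewrite Auv eqSS.
case: (cl u v == k) => //=.
by case: ltngtP => // /ord_inj uv; rewrite uv adj_irr in Auv.
Qed.

Lemma runs_min s0 : ctx s0 -> vars s0 vb <= B ->
  runs B (scan min_body) (scan_cost n min_body)
    (fun s => [/\ agree vk adeg s0 s, arrs s adeg = arrs s0 adeg, vars s vb <= vars s0 vb,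
      forall k, k < n * n -> vars s vb <= arrs s0 adeg (k %/ n) &
      vars s vb = vars s0 vb \/
      exists2 k, k < n * n & vars s vb = arrs s0 adeg (k %/ n)]) s0.
Proof.
move=> cs b0; pose I K (s : state) :=
  [/\ arrs s adeg = arrs s0 adeg, vars s vb <= vars s0 vb,
      forall k, k < K -> vars s vb <= arrs s0 adeg (k %/ n) &
      vars s vb = vars s0 vb \/
      exists2 k, k < n * n & vars s vb = arrs s0 adeg (k %/ n)].
apply: (runs_weaken (leqnn _) _ (runs_scan (I := I) _ _ _ _ _ _)); try by case: cs.
- by move=> s [? []].
- by move=> k s x u; rewrite !inE; case/or4P => /eqP->.
- move=> K s ltK ag sk si sj sv [sd le0 leK wit]; 
  have dE : eval s (at_arr adeg vi) = arrs s0 adeg (K %/ n) by rewrite /= si sd.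
  apply: (@wp_if _ _ (arrs s0 adeg (K %/ n) < vars s vb)); first by rewrite -dE.
  case: ltnP => [lt_b|le_b]; last first.
    by split=> // k; rewrite ltnS leq_eqVlt => /orP[/eqP->|/leK].
  rewrite /wp dE; split; first by apply: leq_trans (ltnW lt_b) _; apply: leq_trans b0.
  split=> //=.
  - exact: leq_trans (ltnW lt_b) le0.
  - move=> k; rewrite ltnS leq_eqVlt => /orP[/eqP->//|/leK].
    exact/leq_trans/ltnW.
  - by right; exists K.
- by split=> //; left.
Qed.

Definition score (dg cn : nat -> nat) q r k :=
  16 * (3 * r < dg (k %/ n) + 3) + 8 * (2 * r < cn (mat k) + 2) + 4
  - (q < dg (k %/ n)) - (q < dg (k %% n)).

Definition holds_pair (s : state) k :=
  [/\ vars s vbi = k %/ n, vars s vbj = k %% n & vars s vbv = mat k].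

Lemma runs_best s0 D C : ctx s0 -> stamps s0 D C -> n * n <= B -> 28 <= B -> vars s0 vb = 0 ->
    (forall k, mat k <= B) ->
  runs B (scan best_body) (scan_cost n best_body)
    (fun s => agree vk adeg s0 s /\
      let sc := score (arrs s0 adeg) (arrs s0 acnt) (vars s0 vq) (vars s0 vr) in
      let lv := live_at D C 1 in
      [/\ forall k, k < n * n -> lv k -> sc k <= vars s vb &
          vars s vb = 0 \/
          exists k, [/\ k < n * n, lv k, vars s vb = sc k & holds_pair s k]]) s0.
Proof.
move=> cs st nB B28 b0 mB.
set sc := score _ _ _ _; set lv := live_at _ _ _.
pose I K (s : state) :=
  [/\ arrs s adeg = arrs s0 adeg, arrs s acnt = arrs s0 acnt,
      forall k, k < K -> lv k -> sc k <= vars s vb &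
      vars s vb = 0 \/
      exists k, [/\ k < n * n, lv k, vars s vb = sc k & holds_pair s k]].
apply: (runs_weaken (leqnn _) _ (runs_scan (I := I) _ _ _ _ _ _)); try by case: cs.
- by move=> s [? []].
- by move=> k s x u; rewrite !inE; case/or4P => /eqP->.
- move=> K s ltK ag sk si sj sv [sd sc' leK wit].
  apply: (wp_if (eval_alive _ cs st ag si sj sv)); rewrite -/lv.
  case lK: (lv K); last first.
    by split=> // k; rewrite ltnS leq_eqVlt => /orP[/eqP->|/leK//]; rewrite lK.
  have mE : vars s vv = mat K by rewrite sv; case: cs.
  have scE : eval s score_expr = sc K.
    by rewrite /= si sj mE sd sc' (proj1 ag vr) // (proj1 ag vq).
  have scB : sc K <= B.
    apply: leq_trans B28; rewrite /sc /score.
    by have := leq_b1 (3 * vars s0 vr < arrs s0 adeg (K %/ n) + 3);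
       have := leq_b1 (2 * vars s0 vr < arrs s0 acnt (mat K) + 2); lia.
  apply: (@wp_if _ _ (vars s vb < sc K)); first by rewrite -scE.
  case: ltnP => [lt_b|le_b]; last first.
    by split=> // k; rewrite ltnS leq_eqVlt => /orP[/eqP->|/leK//].
  rewrite /keep_pair /wp scE; split=> //; cbn -[leq].
  rewrite si sj mE.
  have kB : K <= B by apply: leq_trans (ltnW ltK) nB.
  split; first by apply: leq_trans (leq_div _ _) kB.
  split; first by apply: leq_trans (leq_mod _ _) kB.
  split=> //; split=> //=; last by right; exists K.
  move=> k; rewrite ltnS leq_eqVlt => /orP[/eqP->//|/leK h lk].
  exact: leq_trans (h lk) (ltnW lt_b).
- by split=> //; left.
Qed.

Lemma runs_find s0 D C : ctx s0 -> stamps s0 D C -> n * n <= B -> (forall k, mat k <= B) ->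
  runs B (scan find_body) (scan_cost n find_body)
    (fun s => agree vk adeg s0 s /\
      let lv := live_at D C (vars s0 vr).+1 in
      (exists2 k, k < n * n & lv k) ->
      exists k, [/\ k < n * n, lv k & holds_pair s k]) s0.
Proof.
move=> cs st nB mB; set lv := live_at _ _ _.
pose I K (s : state) := (exists2 k, k < K & lv k) ->
      exists k, [/\ k < n * n, lv k & holds_pair s k].
apply: (runs_weaken (leqnn _) _ (runs_scan (I := I) _ _ _ _ _ _)); try by case: cs.
- by move=> k s x u; rewrite !inE; case/or4P => /eqP->.
- move=> K s ltK ag sk si sj sv IK.
  apply: (wp_if (eval_alive _ cs st ag si sj sv)).
  have -> : eval s (EAdd (EVar vr) (ECst 1)) = (vars s0 vr).+1.
    by rewrite /= (proj1 ag vr) // addn1.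
  rewrite -/lv; case lK: (lv K); last first.
    case=> k; rewrite ltnS leq_eqVlt => /orP[/eqP->|ltk lk]; first by rewrite lK.
    by apply: IK; exists k.
  have mE : vars s vv = mat K by rewrite sv; case: cs.
  rewrite /= si sj mE.
  have kB : K <= B by apply: leq_trans (ltnW ltK) nB.
  split; first by apply: leq_trans (leq_div _ _) kB.
  split; first by apply: leq_trans (leq_mod _ _) kB.
  by split=> // _; exists K.
- by case.
Qed.

End Scans.

(** * Stamps and levels *)

Section Plan.

Variables (n : nat) (G : sgraph n) (col : {set 'I_n} -> nat).
Hypothesis proper : proper_edge_coloring G col.

Notation cl := (cl col).
Notation live := (live G col).

Lemma live_colored D C L : colored_graph cl (live D C L).
Proof.
have sub u v : live D C L u v -> adj G u v by case/and4P.
have irr x : adj G x x = false by apply: adj_irr.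
split; [exact: live_sym | | exact: cl_sym | ].
  by move=> x; apply/negP=> /sub; rewrite irr.
move=> x y z /sub xy /sub xz eq_c; apply/eqP/contraT => nyz.
have edge u v : adj G u v -> [set u; v] \in edges G.
  by move=> uv; apply/imset2P; exists u v => //; rewrite !inE.
have /(_ _ _)/eqP := proper (edge _ _ xy) (edge _ _ xz); case=> //.
  apply: contraNneq nyz => /setP/(_ y); rewrite !inE eqxx orbT => /esym/orP[/eqP yx|//].
  by rewrite yx irr in xy.
by apply/set0Pn; exists x; rewrite !inE eqxx.
Qed.

Lemma eq_rainbow (E E' : rel 'I_n) l : E =2 E' -> rainbow cl E l = rainbow cl E' l.
Proof. by move=> eqE; rewrite /rainbow; congr andb; apply: eq_all => p; apply: eqE. Qed.

Lemma eq_compatible (E E' : rel 'I_n) l : E =2 E' -> compatible cl E l =2 compatible cl E' l.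
Proof. by move=> eqE x y; rewrite /compatible eqE. Qed.

(** With the shift in [live], the lists [l] are the matchings of level [j-1], and
    the new edge is taken from level [j]. *)
Definition extends D C j :=
  forall l, rainbow cl (live D C j) l -> size l = j.-1 ->
  exists x y, compatible cl (live D C j.+1) l x y.

(** At level [r], the stamps given so far are those of the levels above [r]. *)
Definition stamps_ok d r (D : nat -> nat) := forall a, D a = 0 \/ r < D a <= d.

Definition plan_ok d r q D C :=
  [/\ stamps_ok d r D, stamps_ok d r C,
      stage_ok cl (n - d) q r (live D C 1)
    & forall j, r < j <= d -> extends D C j].

Definition stamped r (D D' : nat -> nat) :=
  forall a, D' a = D a \/ D a = 0 /\ D' a = r.

(** A stamp [r] on something unstamped changes neither the graphs of the levels
    above [r] nor that of level [r] itself, and the graph of level [r-1] is the new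
    live graph. *)
Lemma plan_update d r q q' D C D' C' :
    0 < r <= d -> plan_ok d r q D C -> stamped r D D' -> stamped r C C' ->
    stage_ok cl (n - d) q' (r - 1) (live D' C' 1) ->
    (forall l, rainbow cl (live D' C' 1) l -> size l = r.-1 ->
       exists x y, compatible cl (live D C 1) l x y) ->
  plan_ok d (r - 1) q' D' C'.
Proof.
move=> rd [okD okC _ ext] upD upC ok' ext_r.
have ok_up (F F' : nat -> nat) :
    stamps_ok d r F -> stamped r F F' -> stamps_ok d (r - 1) F'.
  by move=> okF upF a; have := okF a; have := upF a; lia.
have high (F F' : nat -> nat) L a : r < L -> stamped r F F' -> (F' a < L) = (F a < L).
  by move=> rL upF; have := upF a; lia.
have hi L : r < L -> live D' C' L =2 live D C L.
  by move=> rL x y; rewrite /live !(high _ _ _ _ rL upD) (high _ _ _ _ rL upC).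
have low (F : nat -> nat) e L a : 0 < L <= e.+1 -> stamps_ok d e F -> (F a < L) = (F a < 1).
  by move=> le okF; have := okF a; lia.
have lo F K e L : 0 < L <= e.+1 -> stamps_ok d e F -> stamps_ok d e K ->
    live F K L =2 live F K 1.
  by move=> le okF okK x y; rewrite /live !(low _ _ _ _ le okF) (low _ _ _ _ le okK).
split=> //; [exact: ok_up upD | exact: ok_up upC | move=> j rj l].
have [->|nj] := eqVneq j r.
  have lo' : live D' C' r =2 live D' C' 1.
    by apply: (lo _ _ (r - 1)); [lia | apply: ok_up upD | apply: ok_up upC].
  have loE : live D C r.+1 =2 live D C 1.
    by apply: (lo _ _ r) => //; lia.
  rewrite (eq_rainbow _ lo') => rl sl; have [x [y cxy]] := ext_r l rl sl.
  by exists x, y; rewrite (eq_compatible _ (hi r.+1 _)) // (eq_compatible _ loE).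
have hj : live D' C' j =2 live D C j by apply: hi; lia.
have hj1 : live D' C' j.+1 =2 live D C j.+1 by apply: hi; lia.
rewrite (eq_rainbow _ hj) => rl sl; have [|x [y cxy]] := ext j _ l rl sl; first by lia.
by exists x, y; rewrite (eq_compatible _ hj1).
Qed.

Lemma plan_vertex d r q D C D' (u : 'I_n) :
    0 < r <= d -> plan_ok d r q D C -> D u = 0 ->
    (forall a : nat, D' a = if a == u then r else D a) ->
    3 * r <= deg (live D C 1) u + 2 ->
  plan_ok d (r - 1) (next_cap q r) D' C.
Proof.
move=> rd ok Du D'E big; have dE : del_vertex (live D C 1) (live D' C 1) u.
  have r0 : (r < 1) = false by lia.
  move=> a b; rewrite /live !D'E -!val_eqE /=.
  by do 2![case: (_ == val u); rewrite ?r0 ?andbF ?andbT //].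
have cg := live_colored D C 1.
apply: (plan_update rd ok).
- by move=> a; rewrite D'E; case: eqP => [->|_]; [right | left].
- by move=> a; left.
- by case: ok => _ _ ok _; apply: stage_del_vertex dE ok => //; case/andP: rd.
move=> l rl sl; apply: (rainbow_extend_vertex cg dE) rl; lia.
Qed.

Lemma plan_color d r q D C C' k :
    0 < r <= d -> plan_ok d r q D C -> C k.+1 = 0 ->
    (forall a : nat, C' a = if a == k.+1 then r else C a) ->
    4 * r <= class_size cl (live D C 1) k + 2 ->
  plan_ok d (r - 1) (next_cap q r) D C'.
Proof.
move=> rd ok Ck C'E big; have dE : del_color cl (live D C 1) (live D C' 1) k.
  move=> a b; rewrite /live !C'E eqSS -!andbA.
  have r0 : (r < 1) = false by lia.
  by case: (_ == k); rewrite ?r0 ?andbT ?andbF.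
have cg := live_colored D C 1.
apply: (plan_update rd ok).
- by move=> a; left.
- by move=> a; rewrite C'E; case: eqP => [->|_]; [right | left].
- by case: ok => _ _ ok _; apply: stage_del_color dE ok => //; case/andP: rd.
move=> l rl sl; apply: (rainbow_extend_color cg dE) rl; lia.
Qed.

Lemma plan_edge d r q D C D' C' (u v : 'I_n) :
    0 < r <= d -> d <= n -> (d - 1) * (6 * d - 4) < d * n ->
    plan_ok d r q D C -> live D C 1 u v ->
    (forall a : nat, D' a = if (a == u) || (a == v) then r else D a) ->
    (forall a : nat, C' a = if a == (cl u v).+1 then r else C a) ->
    (forall w, deg (live D C 1) w <= 3 * r - 3) ->
    (forall k, class_size cl (live D C 1) k <= 4 * r - 4) ->
    (forall a b, live D C 1 a b ->
       (q < deg (live D C 1) u) + (q < deg (live D C 1) v) <=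
       (q < deg (live D C 1) a) + (q < deg (live D C 1) b)) ->
  plan_ok d (r - 1) q D' C'.
Proof.
move=> rd dn big ok luv D'E C'E dle cle best.
have dE : del_edge cl (live D C 1) (live D' C' 1) u v.
  move=> a b; rewrite /live !D'E C'E eqSS -!val_eqE -!andbA.
  have r0 : (r < 1) = false by lia.
  case: (val a == val u); rewrite ?r0 ?andbF //=.
  case: (val a == val v); rewrite ?r0 ?andbF //=.
  case: (val b == val u); rewrite ?r0 ?andbF //=.
  case: (val b == val v); rewrite ?r0 ?andbF //=.
  by case: (_ == cl u v); rewrite ?r0 ?andbF ?andbT.
have cg := live_colored D C 1; have /and4P[_ Du Dv Cuv] := luv.
apply: (plan_update rd ok).
- move=> a; rewrite D'E; case: eqP => [->|_] /=; first by right; lia.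
  by case: eqP => [->|_]; [right; lia | left].
- by move=> a; rewrite C'E; case: eqP => [->|_]; [right; lia | left].
- by case: ok => _ _ ok _; apply: (stage_del_edge cg rd _ dle cle luv best dE ok); rewrite subnK.
by move=> l rl sl; exists u, v; apply: (rainbow_extend_edge cg dE luv rl).
Qed.

Lemma plan_live d r q D C :
    0 < r <= d -> d <= n -> (d - 1) * (6 * d - 4) < d * n ->
    plan_ok d r q D C -> exists u v, live D C 1 u v.
Proof.
move=> rd dn big [_ _ ok _].
have [|_ Phi] := stage_potential rd _ ok; first by rewrite subnK.
by apply: (@potential_edge _ q); apply: leq_trans Phi.
Qed.

Lemma rainbow_cons D C L u v l :
    rainbow cl (live D C L) l -> compatible cl (live D C L.+1) l u v ->
  rainbow cl (live D C L.+1) ((u, v) :: l).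
Proof.
move=> /and3P[al ul cu] /and4P[luv nu nv nc].
have [_ irr _ _] := live_colored D C L.+1.
apply/and3P; split; last by rewrite /= nc.
  rewrite /= luv; apply: sub_all al => p /and4P[A D1 D2 C1].
  by rewrite /live A !ltnS (ltnW D1) (ltnW D2) (ltnW C1).
have nuv : u != v by apply: contraTneq luv => ->; rewrite irr.
have -> : ends ((u, v) :: l) = (u :: map fst l) ++ [:: v] ++ map snd l by [].
by rewrite uniq_catCA /= inE (eq_sym v) (negbTE nuv) /= -/(ends l) nu nv.
Qed.

End Plan.

(** * The program and its correctness *)

Section Main.

Variables (n : nat) (G : sgraph n) (col : {set 'I_n} -> nat).
Hypothesis proper : proper_edge_coloring G col.

Notation cl := (cl col).
Notation live := (live G col).
Notation mat := (mat G col).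
Notation ctx := (ctx G col).

Lemma score_idx (dg cn : nat -> nat) q r (u v : 'I_n) : adj G u v ->
  score G col dg cn q r (idx u v) =
  16 * (3 * r < dg u + 3) + 8 * (2 * r < cn (cl u v).+1 + 2) + 4
  - (q < dg u) - (q < dg v).
Proof. by move=> Auv; rewrite /score mat_idx Auv idx_div idx_mod. Qed.

(** How the winner [(u, v)] of a scan for the best score is to be used. *)
Section Pick.

Variables (dg cn : nat -> nat) (q r : nat) (E : rel 'I_n) (u v : 'I_n).
Hypotheses (r_gt0 : 0 < r) (Euv : E u v).
Hypothesis subE : subrel E (adj G).
Hypothesis dgE : forall w : 'I_n, dg w = deg E w.
Hypothesis cnE : forall a b, E a b -> 2 * cn (cl a b).+1 = class_size cl E (cl a b).

Let sc (a b : 'I_n) := score G col dg cn q r (idx a b).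
Hypothesis best : forall a b, E a b -> sc a b <= sc u v.

Let scE a b : E a b ->
  sc a b = 16 * (3 * r < deg E a + 3) + 8 * (2 * r < cn (cl a b).+1 + 2) + 4
           - (q < deg E a) - (q < deg E b).
Proof. by move=> Eab; rewrite /sc score_idx ?dgE //; apply: subE. Qed.

Lemma pick_vertex : 15 < sc u v -> 3 * r <= deg E u + 2.
Proof.
rewrite scE //; case c3: (3 * r < deg E u + 3); first by lia.
by case: (2 * r < _); do 2!case: (q < _).
Qed.

Lemma pick_color : 7 < sc u v <= 15 -> 4 * r <= class_size cl E (cl u v) + 2.
Proof.
rewrite scE // -cnE //.
case c2: (2 * r < cn (cl u v).+1 + 2); first by lia.
by case: (3 * r < _); do 2!case: (q < _).
Qed.

Lemma pick_edge : sc u v <= 7 ->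
  [/\ forall w, deg E w <= 3 * r - 3,
      forall k, class_size cl E k <= 4 * r - 4 &
      forall a b, E a b ->
       (q < deg E u) + (q < deg E v) <= (q < deg E a) + (q < deg E b)].
Proof.
move=> le7.
have all7 a b : E a b -> (3 * r < deg E a + 3) = false /\
    (2 * r < cn (cl a b).+1 + 2) = false.
  move=> Eab; have := leq_trans (best Eab) le7; rewrite scE //.
  by case: (3 * r < _); case: (2 * r < _) => //=; lia.
split=> [w|k|a b Eab].
- have [/existsP[x Ewx]|] := boolP [exists x, E w x].
    by have [] := all7 w x Ewx; lia.
  rewrite negb_exists => /forallP none; rewrite /deg big1 // => x _.
  by rewrite (negbTE (none x)).
- have [/existsP[a /existsP[b /andP[Eab /eqP <-]]]|] :=
    boolP [exists a, exists b, E a b && (cl a b == k)].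
    by rewrite -cnE //; have [_] := all7 a b Eab; lia.
  rewrite negb_exists => /forallP none; rewrite /class_size big1 // => a _.
  rewrite /cdeg big1 // => b _; have := none a; rewrite negb_exists.
  by move=> /forallP/(_ b)/negbTE ->.
have := best Eab; rewrite !scE //.
have [-> ->] := all7 a b Eab; have [-> ->] := all7 u v Euv.
by do 4!case: (q < _).
Qed.

End Pick.

(** The three actions, according to the score of the best edge. *)
Definition stamp_level : cmd :=
  CIf (ELt (ECst 15) (EVar vb))
    (CPut aD (EVar vbi) (EVar vr))
    (CSeq (CPut aC (EVar vbv) (EVar vr))
      (CIf (ELt (ECst 7) (EVar vb))
        CSkip
        (CSeq (CPut aD (EVar vbi) (EVar vr)) (CPut aD (EVar vbj) (EVar vr))))).

Definition finish_level : cmd :=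
  CSeq stamp_level
 (CSeq (CIf (ELt (ECst 7) (EVar vb))
          (CSet vq (ESub (EVar vq) (EEq (EVar vq) (EVar vr))))
          CSkip)
       (CSet vr (ESub (EVar vr) (ECst 1)))).

Definition plan_level : cmd :=
  CSeq (scan zero_body)
 (CSeq (scan count_body)
 (CSeq (CSet vb (ECst 0))
 (CSeq (scan best_body) finish_level))).

Definition plan_cost : nat :=
  scan_cost n zero_body + (scan_cost n count_body +
    (2 + (scan_cost n best_body + tcost finish_level))).

Definition planning d r (s : state) :=
  [/\ ctx s, vars s vm = 0, vars s vd = d, vars s vr = r
    & exists D C, stamps s D C /\ plan_ok G col d r (vars s vq) D C].

Variables (B d : nat).
Hypothesis nB : n * n <= B.
Hypothesis B28 : 28 <= B.
Hypothesis mB : forall k, mat k <= B.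
Hypothesis d_gt0 : 0 < d.
Hypothesis dn : d < n.
Hypothesis big : (d - 1) * (6 * d - 4) < d * n.

Lemma runs_plan_level r s : 0 < r <= d -> planning d r s ->
  runs B plan_level plan_cost (planning d (r - 1)) s.
Proof.
move=> rd [cs sm sd sr [D [C [st ok]]]]; apply: runs_bounded => -[bv _].
have qB := bv vq; have rB := bv vr.
apply: (runs_then (runs_zero cs)) => s1 [ag1 z1].
have cs1 : ctx s1 by apply: ctx_agree ag1 cs.
have st1 : stamps s1 D C by apply: stamps_agree ag1 st.
apply: (runs_then (runs_count cs1 st1 nB z1)) => s2 [ag2 cnt2].
have ag02 := agree_trans ag1 ag2.
apply: runs_seq; apply: (@runs_wp B (CSet vb (ECst 0))); split=> //.
set s3 := set_var _ _ _.
have ag3 : agree vk adeg s s3 by apply: agree_set_var.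
have cs3 : ctx s3 by apply: ctx_agree ag3 cs.
have st3 : stamps s3 D C by apply: stamps_agree ag3 st.
apply: (runs_then (runs_best cs3 st3 nB B28 erefl mB)).
rewrite [vars s3 vq](proj1 ag3) // [vars s3 vr](proj1 ag3) // sr.
move=> s4 [ag34 [best pick]]; have ag4 := agree_trans ag3 ag34.
set E := live D C 1; have subE : subrel E (adj G) by move=> a b /and4P[].
have dgE (w : 'I_n) : arrs s3 adeg w = deg E w.
  by rewrite -deg_uptoE; have [+ _] := cnt2 _ (idx_lt w w); rewrite idx_div.
have cnE a b : E a b -> 2 * arrs s3 acnt (cl a b).+1 = class_size cl E (cl a b).
  move=> Eab; rewrite -cnt_uptoE; have [_] := cnt2 _ (idx_lt a b).
  by rewrite mat_idx subE // => <-.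
have {}best a b : E a b ->
    score G col (arrs s3 adeg) (arrs s3 acnt) (vars s vq) r (idx a b) <= vars s4 vb.
  by move=> Eab; apply: best; rewrite ?idx_lt ?live_at_idx.
have [u [v [Euv bE hp]]] : exists u v, [/\ E u v, vars s4 vb =
    score G col (arrs s3 adeg) (arrs s3 acnt) (vars s vq) r (idx u v) &
    holds_pair G col s4 (idx u v)].
  case: pick => [b0|[k [ltk lk bE hp]]]; last first.
    have [u [v kE]] := idx_surj ltk; exists u, v; rewrite -kE; split=> //.
    by rewrite /E -live_at_idx // -kE.
  have [a [b Eab]] := plan_live rd (ltnW dn) big ok.
  have := best a b Eab; rewrite b0 score_idx ?subE //.
  by do 4!case: (_ < _).
case: hp; rewrite idx_div idx_mod mat_idx (subE _ _ Euv) => bi bj bvE.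
have r0 : 0 < r by case/andP: rd.
have sr4 : vars s4 vr = r by rewrite (proj1 ag4).
have sq4 : vars s4 vq = vars s vq by rewrite (proj1 ag4).
have sd4 : vars s4 vd = d by rewrite (proj1 ag4).
have sm4 : vars s4 vm = 0 by rewrite (proj1 ag4).
have cs4 : ctx s4 by apply: ctx_agree ag4 cs.
have [sD sC] : stamps s4 D C by apply: stamps_agree ag4 st.
set b := score _ _ _ _ _ _ _ in bE; rewrite bE in best; rewrite sr in rB.
have /and4P[_ Du Dv Cuv] := Euv.
have {}Du : D u = 0 by lia.
have {}Cuv : C (cl u v).+1 = 0 by lia.
have pick_v : 15 < b -> 3 * r <= deg E u + 2.
  exact: (pick_vertex r0 Euv subE dgE).
have pick_c : 7 < b <= 15 -> 4 * r <= class_size cl E (cl u v) + 2.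
  exact: (pick_color r0 Euv subE dgE cnE).
have pick_e := pick_edge r0 Euv subE dgE cnE best.
apply: runs_wp; rewrite /= bE bi bj bvE sr4 sq4.
have [b7|b7] := leqP b 7.
  have -> : (15 < b) = false by lia.
  have [dle cle best_e] := pick_e b7.
  rewrite /=; split=> //; split=> //; split=> //; split; first by lia.
  split=> //=.
  exists (fun a : nat => if (a == u) || (a == v) then r else D a).
  exists (fun a : nat => if a == (cl u v).+1 then r else C a).
  split; last by rewrite sq4; apply: (plan_edge proper rd (ltnW dn) big ok Euv).
  split=> a /=; last by rewrite sC.
  by rewrite sD; case: (a == v); case: (a == u).
have cap : vars s vq - (vars s vq == r) <= B by apply: leq_trans (leq_subr _ _) qB.
have [b15|b15] := leqP b 15 => /=.
  split=> //; split=> //; split; first by lia.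
  split=> //=.
  exists D, (fun a : nat => if a == (cl u v).+1 then r else C a).
  split; last by apply: (plan_color proper rd ok Cuv) => //; apply: pick_c; rewrite b7.
  by split=> a //=; rewrite sC.
split=> //; split=> //; split; first by lia.
split=> //=.
exists (fun a : nat => if a == u then r else D a), C.
split; last by apply: (plan_vertex proper rd ok Du) => //; apply: pick_v.
by split=> a //=; rewrite sD.
Qed.

Lemma output_rcons (s s' : state) m a b :
    vars s vm = m -> vars s' vm = m.+1 ->
    (forall i, i < 2 * m -> arrs s' aout i = arrs s aout i) ->
    arrs s' aout (2 * m) = a -> arrs s' aout (2 * m).+1 = b ->
  output s' = rcons (output s) (a, b).
Proof.
move=> sm sm' same ea eb; rewrite /output [vars s 1]sm [vars s' 1]sm' mkseqS addn1.
rewrite [arrs s' 1 (2 * m)]ea [arrs s' 1 (2 * m).+1]eb.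
congr rcons; apply/eq_in_map => i; rewrite mem_iota add0n => /andP[_ lti].
by rewrite ![arrs s' 1 _]same //; lia.
Qed.

(** The stamp d+1 bars a vertex or color from all later levels; so the stamps of
    the first phase also serve to mark what the matching uses. *)
Definition output_pair : cmd :=
  CSeq (CPut aout (EMul (ECst 2) (EVar vm)) (EVar vbi))
 (CSeq (CPut aout (EAdd (EMul (ECst 2) (EVar vm)) (ECst 1)) (EVar vbj))
 (CSeq (CPut aD (EVar vbi) (EAdd (EVar vd) (ECst 1)))
 (CSeq (CPut aD (EVar vbj) (EAdd (EVar vd) (ECst 1)))
 (CSeq (CPut aC (EVar vbv) (EAdd (EVar vd) (ECst 1)))
 (CSeq (CSet vm (EAdd (EVar vm) (ECst 1)))
       (CSet vr (EAdd (EVar vr) (ECst 1)))))))).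

Definition match_level : cmd := CSeq (scan find_body) output_pair.

Definition match_cost : nat := scan_cost n find_body + tcost output_pair.

Definition pairs (l : seq ('I_n * 'I_n)) : seq (nat * nat) :=
  [seq (val p.1, val p.2) | p <- l].

Definition matching D C r (s : state) :=
  [/\ ctx s, vars s vd = d, vars s vr = r, vars s vm = r.-1 &
    exists l : seq ('I_n * 'I_n),
    [/\ size l = r.-1, rainbow cl (live D C r) l, output s = pairs (rev l) &
        stamps s (fun a => if a \in map val (ends l) then d.+1 else D a)
                 (fun a => if a \in map S (colors cl l) then d.+1 else C a)]].

(** The test of the scan decides compatibility with the edges chosen so far. *)
Lemma compatible_live D C r l (u v : 'I_n) : r <= d ->
  live (fun a => if a \in map val (ends l) then d.+1 else D a)
       (fun a => if a \in map S (colors cl l) then d.+1 else C a) r.+1 u v =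
  compatible cl (live D C r.+1) l u v.
Proof.
move=> rd; rewrite /compatible /live !(mem_map val_inj) (mem_map succn_inj).
have dr : (d.+1 < r.+1) = false by lia.
case: (u \in ends l); rewrite ?dr ?andbF //=.
case: (v \in ends l); rewrite ?dr ?andbF //=.
by case: (_ \in colors cl l); rewrite ?dr ?andbF ?andbT.
Qed.

Lemma runs_match_level D C r s :
    0 < r <= d -> extends G col D C r -> matching D C r s ->
  runs B match_level match_cost (matching D C r.+1) s.
Proof.
move=> rd ext [cs sd sr sm [l [sl rl out st]]].
have [r0 rd'] := andP rd.
apply: (runs_then (runs_find cs st nB mB)); rewrite sr => s1 [ag find].
have [u [v comp]] := ext l rl sl.
have {find} : exists k, [/\ k < n * n, live_at G col
    (fun a => if a \in map val (ends l) then d.+1 else D a)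
    (fun a => if a \in map S (colors cl l) then d.+1 else C a) r.+1 k
    & holds_pair G col s1 k].
  by apply: find; exists (idx u v); rewrite ?idx_lt // live_at_idx compatible_live.
move=> {u v comp} [k [ltk]]; have [u [v ->]] := idx_surj ltk.
rewrite live_at_idx compatible_live // => comp [].
have Auv : adj G u v by case/and4P: comp => /and4P[].
rewrite idx_div idx_mod mat_idx Auv => bi bj bvE.
have cs1 : ctx s1 by apply: ctx_agree ag cs.
have [sD sC] : stamps s1 (fun a => if a \in map val (ends l) then d.+1 else D a)
    (fun a => if a \in map S (colors cl l) then d.+1 else C a).
  by apply: stamps_agree ag st.
have sd1 : vars s1 vd = d by rewrite (proj1 ag).
have sr1 : vars s1 vr = r by rewrite (proj1 ag).
have sm1 : vars s1 vm = r.-1 by rewrite (proj1 ag).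
have nB' : n <= B by apply: leq_trans nB; rewrite leq_pmulr //; lia.
have uB : u <= B by apply: leq_trans nB'; apply: ltnW.
have vB : v <= B by apply: leq_trans nB'; apply: ltnW.
apply: runs_wp; rewrite /= bi bj bvE sd1 sr1 sm1.
do 2!split=> //.
split; first by lia.
split; first by lia.
split; first by lia.
split; first by lia.
split; first by lia.
split=> //=; [by rewrite addn1 | by lia |].
exists ((u, v) :: l); split.
- by rewrite /= sl prednK.
- exact: rainbow_cons.
- rewrite rev_cons /pairs map_rcons -/(pairs _) -out.
  apply: (output_rcons sm); rewrite /= ?addn1 ?eqxx //.
    by move=> i lti; rewrite !ifF ?(proj2 ag) //; apply: ltn_eqF; lia.
  by rewrite ifF // ltn_eqF.
- split=> a /=.
    rewrite sD addn1 /ends /= !map_cat /= mem_cat !inE.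
    rewrite (eq_sym a (val v)) (eq_sym a (val u)) !mem_cat.
    rewrite in_cons (eq_sym a (val v)).
    by case: (val v == a); case: (val u == a); rewrite ?orbT.
  by rewrite sC addn1 in_cons; case: (a == _).
Qed.

Definition set_targets : cmd :=
  CSeq (CSet vd (EVar vb)) (CSeq (CSet vr (EVar vb)) (CSet vq (EVar vb))).

Definition plan_phase : cmd := CWhile (ELt (ECst 0) (EVar vr)) plan_level.

Definition match_phase : cmd :=
  CSeq (CSet vr (ECst 1))
       (CWhile (ELt (EVar vr) (EAdd (EVar vd) (ECst 1))) match_level).

(** The arrays of degrees and counts start at 0, so the first count needs no
    reset; the minimum degree is then the minimum over all cells of the degree of
    the row. *)
Definition rainbow_prog : cmd :=
  CSeq (CSet vN (EMul (EVar vn) (EVar vn)))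
 (CSeq (scan count_body)
 (CSeq (CSet vb (EVar vn))
 (CSeq (scan min_body)
 (CSeq set_targets
 (CSeq plan_phase match_phase))))).

Definition prog_cost : nat :=
  4 + (scan_cost n count_body + (2 + (scan_cost n min_body + (6 +
    ((d * (3 + plan_cost).+1 + 4) + (2 + (d * (5 + match_cost).+1 + 6))))))).

Lemma degree_live (u : 'I_n) : deg (live (fun=> 0) (fun=> 0) 1) u = degree G u.
Proof.
rewrite /degree -sum1_card [RHS]big_mkcond; apply: eq_bigr => v _ /=.
by rewrite inE /live !andbT; case: (adj G u v).
Qed.

Lemma min_degree_le (u : 'I_n) : min_degree G <= degree G u.
Proof.
have: u \in index_enum 'I_n by rewrite mem_index_enum.
rewrite /min_degree; elim: (index_enum _) => // v s IH.
by rewrite inE big_cons geq_min => /orP[/eqP<-|/IH->]; rewrite ?leqnn ?orbT.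
Qed.

Lemma min_degree_ge m : m <= n -> (forall u : 'I_n, m <= degree G u) -> m <= min_degree G.
Proof.
move=> mn mdeg; rewrite /min_degree.
by elim/big_ind: _ => // x y mx my; rewrite leq_min mx.
Qed.

(** No vertex is adjacent to itself. *)
Lemma min_degree_lt : 0 < n -> min_degree G < n.
Proof.
move=> n0; apply: leq_ltn_trans (min_degree_le (Ordinal n0)) _.
rewrite /degree -[ltnRHS]card_ord; apply: proper_card.
apply/properP; split; first exact/subsetP.
by exists (Ordinal n0) => //; rewrite inE adj_irr.
Qed.

Hypothesis d_min : d = min_degree G.

Lemma runs_prog : runs B rainbow_prog prog_cost
  (fun s => exists D C, matching D C d.+1 s) (input G col).
Proof.
apply: runs_then (runs_wp (Q := (fun s => s = set_var (input G col) vN (n * n))) _) _.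
  by split.
move=> s0 ->; set s1 := set_var _ _ _.
have cs1 : ctx s1 by split.
have st1 : stamps s1 (fun=> 0) (fun=> 0) by split.
have z1 k : k < n * n -> arrs s1 adeg (k %/ n) = 0 /\ arrs s1 acnt (mat k) = 0 by [].
apply: (runs_then (runs_count cs1 st1 nB z1)) => s2 [ag2 cnt2].
have dgE (u : 'I_n) : arrs s2 adeg u = degree G u.
  rewrite -degree_live -deg_uptoE; have [+ _] := cnt2 _ (idx_lt u u).
  by rewrite idx_div.
have nB' : n <= B by apply: leq_trans nB; rewrite leq_pmulr //; lia.
have n2 : vars s2 vn = n by rewrite (proj1 ag2).
apply: runs_then (runs_wp (Q := (fun s => s = set_var s2 vb n)) _) _.
  by rewrite /= n2.
move=> s0' ->; set s3 := set_var _ _ _.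
have ag3 : agree vk adeg s1 s3 by apply: agree_set_var.
have cs3 : ctx s3 by apply: ctx_agree ag3 cs1.
apply: (runs_then (runs_min cs3 _)) => // s4 [ag34 _ le_n le_deg wit].
have ag4 := agree_trans ag3 ag34.
have b4 : vars s4 vb = d.
  apply/eqP; rewrite d_min eqn_leq; apply/andP; split.
    apply: min_degree_ge => // u; rewrite -dgE.
    by have := le_deg _ (idx_lt u u); rewrite idx_div.
  case: wit => [->|[k ltk ->]]; first by rewrite -d_min ltnW.
  have [u [v ->]] := idx_surj ltk.
  by rewrite idx_div [arrs s3 adeg u]dgE min_degree_le.
have cs4 : ctx s4 by apply: ctx_agree ag4 cs1.
have [sD4 sC4] : stamps s4 (fun=> 0) (fun=> 0) by apply: stamps_agree ag4 st1.
have sm4 : vars s4 vm = 0 by rewrite (proj1 ag4).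
have dB : d <= B by apply: leq_trans nB'; apply: ltnW.
apply: runs_then (runs_wp (Q := planning d d) _) _.
  rewrite /= b4; split=> //; split=> //; split=> //; split=> //=.
  exists (fun=> 0), (fun=> 0); split; first by split.
  split; [by left | by left | | by move=> j; lia].
  constructor 2; split=> //; rewrite subnK ?(ltnW dn) //.
  rewrite (eq_bigr (fun=> 1)) => [|u _]; first by rewrite sum1_card card_ord.
  by rewrite degree_live d_min min_degree_le.
move=> s5 plan5; apply: (runs_then (Q1 := planning d (d - d))).
  pose I k := planning d (d - k).
  apply: (runs_while (I := I) (N := d) (T := plan_cost)).
  - move=> k s ltk Ik; split; last first.
      by rewrite /I subnS -subn1; apply: runs_plan_level => //; lia.
    by case: Ik => _ _ _ sr _; rewrite /= sr; lia.
  - by move=> s [_ _ _ sr _]; rewrite /= sr subnn.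
  - by rewrite /I subn0.
rewrite subnn => s6 [cs6 sm6 sd6 sr6 [D [C [st6 [_ _ _ ext]]]]].
apply: runs_then (runs_wp (Q := matching D C 1) _) _.
  rewrite /=; split; first by lia.
  split=> //=; exists [::]; split=> //.
    by rewrite /output [vars _ _]sm6.
pose I k := matching D C k.+1.
move=> s7 match7; apply: runs_weaken (runs_while (I := I) (N := d) (T := match_cost) _ _ match7).
- by [].
- by move=> s I_d; exists D, C.
- move=> k s ltk Ik; split; last by apply: runs_match_level => //; apply: ext; lia.
  by case: Ik => _ sd sr _ _; rewrite /= sd sr; lia.
- by move=> s [_ sd sr _ _]; rewrite /= sd sr; lia.
Qed.

End Main.

(** * Arithmetic, and the matching as a set of edges *)

Lemma prog_cost_le n d : 0 < n -> 0 < d ->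
  prog_cost n d <= 10 * 100 * (d * n ^ 2).
Proof.
move=> n0 d0.
(* The numerals are the computed costs of the loop-free bodies. *)
have -> : prog_cost n d = 4 + (2 + (n * n * 52 + 4) + (2 + (2 + (n * n * 27 + 4) + (6 +
  ((d * (3 + (2 + (n * n * 25 + 4) + (2 + (n * n * 52 + 4) +
      (2 + (2 + (n * n * 114 + 4) + 31))))).+1 + 4) +
   (2 + (d * (5 + (2 + (n * n * 50 + 4) + 35)).+1 + 6))))))) by [].
rewrite -mulnn; have: 0 < n * n by rewrite muln_gt0 n0.
move: (n * n) => N N0.
have : d <= d * N by rewrite leq_pmulr.
have : N <= d * N by rewrite leq_pmull.
lia.
Qed.

(** The product of [vn] with itself has the only quadratic bound. *)
Lemma prog_fits B W : 28 <= B -> B * B <= W -> cfits B W rainbow_prog.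
Proof.
move=> B28 BW; have BW' : 28 * B <= W by apply: leq_trans BW; rewrite leq_mul2r B28 orbT.
rewrite /= BW.
do ! [apply/andP; split] => //; apply: leq_trans BW'; lia.
Qed.


Lemma uniq_map_inj (T1 T2 : eqType) (f : T1 -> T2) (s : seq T1) :
  uniq (map f s) -> {in s &, injective f}.
Proof.
elim: s => // a s IH /= /andP[fa us] x y; rewrite !inE.
case/predU1P=> [->|xs]; case/predU1P=> [->|ys] // e; last exact: IH.
  by rewrite e map_f in fa.
by rewrite -e map_f in fa.
Qed.

Lemma ends_inj (T : finType) (l : seq (T * T)) p p' :
    uniq (ends l) -> p \in l -> p' \in l ->
    [set p.1; p.2] :&: [set p'.1; p'.2] != set0 ->
  p = p'.
Proof.
rewrite cat_uniq => /and3P[u1 /hasPn dis u2] pl pl' /set0Pn[x].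
have inj (f : T * T -> T) : uniq (map f l) -> f p = f p' -> p = p'.
  by move=> uf ef; apply: (uniq_map_inj uf).
have ne q q' : q \in l -> q' \in l -> q.1 = q'.2 -> p = p'.
  move=> ql ql' e; have /dis/negP[] := map_f snd ql'.
  by rewrite -e map_f.
rewrite !inE => /andP[/orP[]/eqP-> /orP[]/eqP e].
- exact: inj e.
- exact: ne e.
- exact: (ne _ _ pl' pl).
- exact: inj e.
Qed.

Lemma rainbow_matching_of_seq (n : nat) (G : sgraph n) (col : {set 'I_n} -> nat)
    (l : seq ('I_n * 'I_n)) :
    rainbow (cl col) (adj G) l ->
  let L := [seq [set p.1; p.2] | p <- l] in
  [/\ uniq L, rainbow_matching G col [set:: L] & #|[set:: L]| = size l].
Proof.
move=> /and3P[/allP El ul cul] L.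
have uL : uniq L.
  rewrite map_inj_in_uniq; last first.
    move=> p p' pl pl' e; apply: (ends_inj ul) => //.
    by rewrite e setIid; apply/set0Pn; exists p'.1; rewrite !inE eqxx.
  by move: ul; rewrite cat_uniq => /and3P[/map_uniq].
split=> //; last by rewrite cardsE (card_uniqP uL) size_map.
split.
- apply/subsetP => e; rewrite inE => /mapP[p pl ->]; apply/imset2P.
  by exists p.1 p.2 => //; rewrite !inE; apply: El.
- apply/trivIsetP => e f; rewrite !inE => /mapP[p pl ->] /mapP[p' pl' ->].
  apply: contraR; rewrite -setI_eq0 => /(ends_inj ul pl pl') ->.
  exact: eqxx.
- move=> e f; rewrite !inE => /mapP[p pl ->] /mapP[p' pl' ->] ec.
  by rewrite (uniq_map_inj cul pl pl' ec).
Qed.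

Import Order.TTheory GRing.Theory Num.Theory.

(** Stated for variables, so that field and ring do not meet casts of naturals. *)
Lemma clear_fraction (x y : rat) : (0 < x ->
  13%:R / 2%:R * x - 23%:R / 2%:R + 41%:R / (8%:R * x) < y ->
  52%:R * x * x + 41%:R < 8%:R * x * y + 92%:R * x)%R.
Proof.
move=> x0; have -> : (13%:R / 2%:R * x - 23%:R / 2%:R + 41%:R / (8%:R * x) =
    (52%:R * x * x - 92%:R * x + 41%:R) / (8%:R * x))%R.
  by field; rewrite gt_eqF.
have x8 : (0 < 8%:R * x)%R by rewrite pmulr_rgt0 ?ltr0n.
rewrite (ltr_pdivrMr _ _ x8) => lt_y.
rewrite -subr_gt0 in lt_y; rewrite -subr_gt0.
suff -> : (8%:R * x * y + 92%:R * x - (52%:R * x * x + 41%:R) =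
  y * (8%:R * x) - (52%:R * x * x - 92%:R * x + 41%:R))%R by exact: lt_y.
by ring.
Qed.

(** Cleared of fractions, the hypothesis reads 8dn > 52d^2 - 92d + 41, which
    exceeds 8(d-1)(6d-4) by (2d-3)^2. *)
Lemma large_order (n d : nat) : 0 < d ->
    (13%:R / 2%:R * d%:R - 23%:R / 2%:R + 41%:R / (8%:R * d%:R) < n%:R :> rat)%R ->
  (d - 1) * (6 * d - 4) < d * n.
Proof.
move=> d0 lt_n; have nat_lt : 52 * d * d + 41 < 8 * d * n + 92 * d.
  rewrite -(ltr_nat rat) natrD [ltRHS]natrD !natrM.
  by apply: clear_fraction lt_n; rewrite ltr0n.
have [e dE] : exists e, d = e.+1 by exists d.-1; lia.
move: nat_lt; rewrite dE.
have -> : (e.+1 - 1) * (6 * e.+1 - 4) = e * (6 * e + 2) by congr muln; lia.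
nia.
Qed.

(** Powers of the base, which is at least 2, absorb the constant 28. *)
Lemma word_bound_ge (n : nat) (G : sgraph n) (col : {set 'I_n} -> nat) B :
    0 < n -> B = n * n + (max_color G col).+1 + 28 ->
  B * B <= word_bound (10 * 100) 14 G col.
Proof.
move=> n0 BE; rewrite /word_bound; set S := n + _ + 1.
have S2 : 2 <= S by rewrite /S; lia.
have BS : B <= S ^ 7.
  rewrite (expnD S 2 5) -mulnn; (* 30 <= 2 ^ 5 <= S ^ 5 *)
  apply: (@leq_trans (S * S * 2 ^ 5)).
    have : n * n + (max_color G col).+1 <= S * S by rewrite /S; nia.
    have : 1 <= S * S by rewrite muln_gt0; lia.
    rewrite BE; lia.
  by rewrite leq_mul2l leq_exp2r // S2 orbT.
apply: (@leq_trans (S ^ 14)); last by apply: leq_pmull.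
by rewrite (expnD S 7 7) leq_mul.
Qed.

Theorem mainTheorem3 :
  exists (prog : cmd) (K d : nat),
    forall (n : nat) (G : sgraph n) (col : {set 'I_n} -> nat),
      proper_edge_coloring G col ->
      1 <= min_degree G ->
      (n%:R > 13%:R / 2%:R * (min_degree G)%:R - 23%:R / 2%:R
              + 41%:R / (8%:R * (min_degree G)%:R) :> rat)%R ->
      exists (t : nat) (s : state) (M : {set {set 'I_n}}),
        [/\ exec (word_bound K d G col) prog (input G col) t s,
            t <= K * (min_degree G * n ^ 2),
            outputs s M,
            rainbow_matching G col M
          & #|M| = min_degree G].
Proof.
exists rainbow_prog, (10 * 100), 14 => n G col proper d1 size_n.
have n0 : 0 < n.
  by case: n G col proper d1 size_n => // G col _; rewrite /min_degree big_ord0.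
have dn := min_degree_lt G n0.
have big := large_order d1 size_n.
pose B := n * n + (max_color G col).+1 + 28.
have nB : n * n <= B by rewrite /B; lia.
have B28 : 28 <= B by rewrite /B; lia.
have matB k : mat G col k <= B by have := mat_le G col k; rewrite /B; lia.
have BW : B * B <= word_bound (10 * 100) 14 G col by apply: word_bound_ge.
have bounded0 : bounded B (input G col).
  split=> [x|a k] /=; last by case: (a == 0) => //; apply: matB.
  by case: (x == 0) => //; apply: leq_trans nB; rewrite leq_pmulr.
have [t [s [ex le_t _ [D [C [_ _ _ _ [l [sl rl out _]]]]]]]] :=
  runs_prog proper nB B28 matB d1 dn big erefl (prog_fits B28 BW) bounded0.
have radj : rainbow (cl col) (adj G) (rev l).
  case/and3P: rl => al ul cul; rewrite /rainbow all_rev /colors map_rev rev_uniq cul.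
  rewrite (sub_all _ al) => [|p /and4P[]//]; rewrite andbT /=.
  move: ul; rewrite /ends !map_rev !cat_uniq !rev_uniq.
  by rewrite (eq_has (mem_rev _)) has_rev.
have [uL rM cM] := rainbow_matching_of_seq radj.
exists t, s, [set:: [seq [set p.1; p.2] | p <- rev l]]; split=> //.
- by apply: leq_trans le_t _; apply: prog_cost_le.
- by exists (rev l).
- by rewrite cM size_rev sl.
Qed.
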